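(* Let $n,k$ be positive integers, let $\mathfrak{g}=\mathfrak{gl}_n$ and let $V=\bigwedge\mathbb{C}^n$ be the exterior algebra of the natural representation. For a partition $\lambda$ contained in an $n\times k$ rectangle, define $$M^A_q(\lambda)=\det\left[\genfrac{[}{]}{0pt}{}{k+i}{j+\lambda_{n-j}}_q\right]_{i,j=0}^{n-1}.$$ Let $a_i=\lambda_i+n-i$. Then $$M^A_q(\lambda)=q^{\|\overline\lambda\|}\,\frac{\prod_{m=0}^{n-1}[k+m]_q!\,\prod_{1\le i<j\le n}[a_i-a_j]_q}{\prod_{i=1}^n[a_i]_q!\,[k+n-1-a_i]_q!}=q^{\|\overline\lambda\|}\dim_q(\overline\lambda')=q^{\|\overline\lambda\|}\dim_q(\lambda')\in\mathbb{Z}_{\ge0}[q],$$ where $\dim_q(\nu)$ is the $q$-dimension of the irreducible representation $V(\nu)$ of $\mathfrak{gl}_k$. Moreover, $M^A_1(\lambda)$ is equal to the multiplicity of the irreducible $\mathfrak{gl}_n$-representation $V(\lambda)$ in $V^{\otimes k}$.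
   Context: $[m]_q=1+q+\cdots+q^{m-1}$, $[m]_q!=\prod_{j=1}^m[j]_q$, $\genfrac{[}{]}{0pt}{}{a}{b}_q=\frac{[a]_q!}{[b]_q![a-b]_q!}$ (zero if $b<0$ or $b>a$). A partition contained in an $n\times k$ rectangle has at most $n$ parts (rows), each at most $k$; it is padded with zeros to $n$ parts. $\overline\lambda$ is its complement in the rectangle: $\overline\lambda_i=k-\lambda_{n+1-i}$, $1\le i\le n$. A prime denotes the conjugate partition. $\|\nu\|=\sum_i(i-1)\nu_i$. The $q$-dimension of the irreducible highest weight representation $V(\nu)$ is $\dim_q(\nu)=\prod_{\alpha\in\Phi^+}\frac{1-q^{\langle\nu+\rho,\alpha^\vee\rangle}}{1-q^{\langle\rho,\alpha^\vee\rangle}}$; for $\mathfrak{gl}_k$ this is $\prod_{1\le i<j\le k}\frac{1-q^{\nu_i-\nu_j+j-i}}{1-q^{j-i}}$. *)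

(* Defs.v *)
From HB Require Import structures.
From mathcomp Require Import all_boot all_order all_algebra.
From mathcomp Require Import ssrAC.
From mathcomp Require Import boolp reals.
From mathcomp Require Import complex.

Set Implicit Arguments.
Unset Strict Implicit.
Unset Printing Implicit Defensive.

Import GRing.Theory.
Local Open Scope ring_scope.

(** Taking q := 'X in the fraction field of {poly int} gives the identities
    between rational functions in an indeterminate; q := 1 in rat gives the
    specialisation at q = 1. *)

Section QAnalogues.
Variables (K : fieldType) (q : K).

Definition qint (m : nat) : K := \sum_(i < m) q ^+ i.

Definition qfact (m : nat) : K := \prod_(1 <= j < m.+1) qint j.

Definition qbinom (a b : nat) : K :=
  if (b <= a)%N then qfact a / (qfact b * qfact (a - b)) else 0.

End QAnalogues.

(** A partition is a weakly decreasing list of naturals, padded with zeros;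
    [part nu i] is nu_i, with i starting at 1. *)

Definition part (nu : seq nat) (i : nat) : nat := nth 0%N nu i.-1.

Definition in_rect (n k : nat) (la : seq nat) : Prop :=
  [/\ size la = n, sorted geq la & all (fun x => x <= k)%N la].

Definition complement (n k : nat) (la : seq nat) : seq nat :=
  [seq (k - part la (n.+1 - i))%N | i <- iota 1 n].

(** The conjugate of a partition with parts at most k, padded to k parts. *)
Definition conj_part (k : nat) (la : seq nat) : seq nat :=
  [seq count (fun x => j <= x)%N la | j <- iota 1 k].

Definition part_norm (nu : seq nat) : nat :=
  (\sum_(1 <= i < (size nu).+1) i.-1 * part nu i)%N.

(** The truncated subtraction nu_i - nu_j is a true one since nu is weakly
    decreasing. *)
Definition qdim (K : fieldType) (q : K) (k : nat) (nu : seq nat) : K :=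
  \prod_(1 <= i < k.+1) \prod_(i.+1 <= j < k.+1)
    ((1 - q ^+ (part nu i - part nu j + (j - i))) / (1 - q ^+ (j - i))).

Definition MA (K : fieldType) (q : K) (n k : nat) (la : seq nat) : K :=
  \det (\matrix_(i < n, j < n) qbinom q (k + i) (j + part la (n - j))).

Notation coord F I := {ffun I -> F^o}.

Definition bvec (F : fieldType) (I : finType) (i : I) : coord F I :=
  [ffun j => (j == i)%:R].

(** A representation of the Lie algebra gl_n(F) = 'M[F]_n on a space with a
    basis indexed by [rep_idx]. *)
Record glRep (F : fieldType) (n : nat) := GlRep {
  rep_idx : finType;
  rep_act : 'M[F]_n -> coord F rep_idx -> coord F rep_idx;
  rep_linear : forall A, linear (rep_act A);
  rep_linearl : forall x, linear (rep_act^~ x);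
  rep_bracket : forall (A B : 'M[F]_n) x,
    rep_act (A *m B - B *m A) x
      = rep_act A (rep_act B x) - rep_act B (rep_act A x)
}.

HB.instance Definition _ (F : fieldType) (n : nat) (W : glRep F n) A :=
  GRing.isLinear.Build F (coord F (rep_idx W)) (coord F (rep_idx W)) *:%R
    (@rep_act F n W A) (@rep_linear F n W A).

Section Multiplicity.
Variables (F : fieldType) (n : nat) (W : glRep F n).
Local Notation space := (coord F (rep_idx W)).

Definition subrep (U : {vspace space}) : Prop :=
  forall (A : 'M[F]_n) (x : space), x \in U -> rep_act A x \in U.

Definition irreducible_subrep (U : {vspace space}) : Prop :=
  [/\ subrep U, U != 0%VS
    & forall U' : {vspace space}, subrep U' -> (U' <= U)%VS ->
        U' = 0%VS \/ U' = U].

(** U has a highest weight vector of weight la, with respect to the Borel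
    subalgebra of upper triangular matrices; for an irreducible U this says
    that U is (isomorphic to) V(la). *)
Definition has_highest_weight (U : {vspace space}) (la : seq nat) : Prop :=
  exists v : space, [/\ v \in U, v != 0,
    forall i j : 'I_n, (i < j)%N -> rep_act (delta_mx i j) v = 0
    & forall i : 'I_n, rep_act (delta_mx i i) v = (part la i.+1)%:R *: v].

Definition irreducible_decomposition (r : nat) (U : 'I_r -> {vspace space}) :=
  [/\ forall i, irreducible_subrep (U i),
      (\sum_(i < r) U i)%VS = fullv
    & directv (\sum_(i < r) U i)].

(** The representation is completely reducible, and m of the summands of any
    decomposition into irreducibles are isomorphic to V(la). *)
Definition is_multiplicity (la : seq nat) (m : nat) : Prop :=
  (exists r (U : 'I_r -> {vspace space}), irreducible_decomposition U) /\
  (forall r (U : 'I_r -> {vspace space}), irreducible_decomposition U ->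
     #|[set i | `[< has_highest_weight (U i) la >]]| = m).

End Multiplicity.

Lemma coordE (F : fieldType) (I : finType) (x : coord F I) :
  x = \sum_i x i *: bvec F i.
Proof.
apply/ffunP => j; rewrite sum_ffunE (bigD1 j) //= !ffunE eqxx big1.
  by rewrite addr0 /GRing.scale /= mulr1.
by move=> i /negPf ne; rewrite !ffunE eq_sym ne scaler0.
Qed.

Lemma linear_coord_ext (F : fieldType) (I : finType) (V : lmodType F)
    (f g : {linear coord F I -> V}) :
  (forall i, f (bvec F i) = g (bvec F i)) -> f =1 g.
Proof.
move=> fg x; rewrite (coordE x) !linear_sum.
by apply: eq_bigr => i _; rewrite !linearZ fg.
Qed.

(** The basis of the exterior algebra of F^n is indexed by {set 'I_n}: the set
    {s_1 < ... < s_r} stands for e_(s_1) /\ ... /\ e_(s_r), see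
    [bvec_bigwedge] below. *)

Section Exterior.
Variables (F : fieldType) (n : nat).
Local Notation ext := (coord F {set 'I_n}).

Definition inversions (S T : {set 'I_n}) : nat :=
  #|[set p : 'I_n * 'I_n | [&& p.1 \in S, p.2 \in T & (p.2 < p.1)%N]]|.

Definition bwedge (S T : {set 'I_n}) : ext :=
  if [disjoint S & T] then (-1) ^+ inversions S T *: bvec F (S :|: T) else 0.

Definition wedge (x y : ext) : ext :=
  \sum_S \sum_T (x S * y T) *: bwedge S T.

Definition ext1 : ext := bvec F set0.

Definition ext_vec (v : 'cV[F]_n) : ext := \sum_i v i 0 *: bvec F [set i].

(** The matrix A acts as the derivation which extends v |-> A *m v:
    A (v_1 /\ ... /\ v_r) = \sum_p v_1 /\ ... /\ A v_p /\ ... /\ v_r. *)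
Definition ext_act (A : 'M[F]_n) (x : ext) : ext :=
  \sum_S x S *: \sum_(j in S)
    \big[wedge/ext1]_(i <- enum S)
      ext_vec (if i == j then A *m delta_mx i 0 else delta_mx i 0).

Local Notation before S i := #|[set s in S | (s < i)%N]|.

Definition creation (i : 'I_n) (x : ext) : ext :=
  [ffun T : {set 'I_n} => if i \in T then (-1) ^+ before T i * x (T :\ i) else 0].

Definition annihilation (i : 'I_n) (x : ext) : ext :=
  [ffun T : {set 'I_n} => if i \in T then 0 else (-1) ^+ before T i * x (i |: T)].

Fact creation_linear i : linear (creation i).
Proof.
move=> a x y; apply/ffunP=> T; rewrite !ffunE; case: ifP => _.
  by rewrite mulrDr -!scalerAr.
by rewrite scaler0 addr0.
Qed.
HB.instance Definition _ i :=
  GRing.isLinear.Build F ext ext *:%R (creation i) (creation_linear i).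

Fact annihilation_linear i : linear (annihilation i).
Proof.
move=> a x y; apply/ffunP=> T; rewrite !ffunE; case: ifP => _.
  by rewrite scaler0 addr0.
by rewrite mulrDr -!scalerAr.
Qed.
HB.instance Definition _ i :=
  GRing.isLinear.Build F ext ext *:%R (annihilation i) (annihilation_linear i).

Lemma before_D1 (T : {set 'I_n}) i j : i \in T ->
  before T j = ((i < j) + before (T :\ i) j)%N.
Proof.
move=> iT; case: (boolP (i < j)%N) => ij.
  rewrite (cardsD1 i) !inE iT ij /=; congr (_ + _)%N.
  by apply: eq_card => s; rewrite !inE andbA.
apply: eq_card => s; rewrite !inE; case: eqP => [->|//].
by rewrite (negPf ij) andbF.
Qed.

Lemma before_D1id (T : {set 'I_n}) i : before (T :\ i) i = before T i.
Proof.
case: (boolP (i \in T)) => iT; first by rewrite (before_D1 i iT) ltnn.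
by congr #|pred_of_set _|; apply/setP => s; rewrite !inE; case: eqP => // ->;
   rewrite (negPf iT).
Qed.

Lemma before_U1id (T : {set 'I_n}) i : before (i |: T) i = before T i.
Proof.
by apply: eq_card => s; rewrite !inE; case: eqP => [->|//]; rewrite ltnn !andbF.
Qed.

Lemma creationC i j x :
  creation i (creation j x) = - creation j (creation i x).
Proof.
apply/ffunP=> T; rewrite !ffunE !inE.
have [->|ne] := eqVneq i j.
  by rewrite /= mulr0 if_same oppr0.
case: (boolP (i \in T)) => iT; case: (boolP (j \in T)) => jT /=;
  rewrite ?mulr0 ?oppr0 //.
rewrite -mulrN (before_D1 i jT) (before_D1 j iT) !exprD.
have -> : T :\ i :\ j = T :\ j :\ i by rewrite !setDDl setUC.
case: (ltngtP i j) => [ij|ij|/ord_inj e] /=; last by rewrite e eqxx in ne.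
  by rewrite expr0 expr1 !mul1r !mulN1r mulrCA mulNr mulrN opprK.
by rewrite expr0 expr1 !mul1r !mulN1r mulrCA mulNr mulrN.
Qed.

Lemma annihilation_creation i j x :
  annihilation i (creation j x) + creation j (annihilation i x)
    = (i == j)%:R *: x.
Proof.
apply/ffunP=> T; rewrite !ffunE !inE.
have [<-|ne] := eqVneq i j.
  rewrite /= scale1r; case: (boolP (i \in T)) => iT.
    rewrite add0r setD1K // before_D1id mulrA -expr2 sqrr_sign mul1r //.
  by rewrite addr0 setU1K // before_U1id mulrA -expr2 sqrr_sign mul1r.
rewrite /= scale0r.
case: (boolP (i \in T)) => iT; case: (boolP (j \in T)) => jT /=;
  rewrite ?mulr0 ?andbF ?addr0 ?add0r //.
have -> : (i |: T) :\ j = i |: T :\ j.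
  by apply/setP => s; rewrite !inE; case: (eqVneq s i) => // ->; rewrite ne.
have iUT : i \in i |: T by rewrite setU11.
rewrite (before_D1 j iUT) setU1K // (before_D1 i jT) !exprD !mulrA -mulrDl.
rewrite [X in X * _](_ : _ = 0) ?mul0r //.
case: (ltngtP i j) => [ij|ij|/ord_inj e] /=; last by rewrite e eqxx in ne.
  by rewrite expr0 expr1 !mul1r mulrN1 mulNr mulrC addNr.
by rewrite expr0 expr1 mulr1 mulN1r mulNr mulrC addNr.
Qed.

Lemma inversions1 i (S : {set 'I_n}) : inversions [set i] S = before S i.
Proof.
rewrite /inversions -(card_imset [set s in S | _] (f := pair i)); last by move=> ? ? [].
apply: eq_card => -[a b]; rewrite !inE /=; apply/idP/imsetP.
  by move=> /and3P[/eqP -> bS ba]; exists b; rewrite // inE bS ba.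
by case=> s; rewrite inE => /andP[sS si] [-> ->]; rewrite eqxx sS si.
Qed.

Lemma wedge_bvecl S y : wedge (bvec F S) y = \sum_T y T *: bwedge S T.
Proof.
rewrite /wedge (bigD1 S) //= [X in _ + X]big1 ?addr0.
  by apply: eq_bigr => T _; rewrite ffunE eqxx mul1r.
by move=> S' /negPf ne; apply: big1 => T _; rewrite ffunE ne mul0r scale0r.
Qed.

Lemma creation_bvec i S :
  creation i (bvec F S) =
    if i \in S then 0 else (-1) ^+ before S i *: bvec F (i |: S).
Proof.
apply/ffunP => T; case: (boolP (i \in S)) => iS; rewrite !ffunE.
  case: ifP => // iT; rewrite (_ : (T :\ i == S) = false) ?mulr0 //.
  by apply/eqP => e; rewrite -e !inE eqxx in iS.
case: (boolP (i \in T)) => iT; last first.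
  rewrite (_ : (T == _) = false) ?scaler0 //.
  by apply/eqP => e; rewrite e setU11 in iT.
rewrite -[LHS]/(_ *: _ : F^o) -before_D1id.
have -> : (T == i |: S) = (T :\ i == S).
  by apply/eqP/eqP => [->|<-]; rewrite ?setU1K ?setD1K.
by case: eqP => [->|_] //; rewrite !scaler0.
Qed.

Lemma wedge1E i x : wedge (bvec F [set i]) x = creation i x.
Proof.
rewrite wedge_bvecl {2}(coordE x) linear_sum; apply: eq_bigr => S _.
rewrite linearZ /= creation_bvec /bwedge disjoints1 inversions1.
by case: (i \in S).
Qed.

Lemma wedge_vecE v x : wedge (ext_vec v) x = \sum_i v i 0 *: creation i x.
Proof.
transitivity (\sum_i v i 0 *: wedge (bvec F [set i]) x); last first.
  by apply: eq_bigr => i _; rewrite wedge1E.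
rewrite /wedge; under [RHS]eq_bigr do rewrite scaler_sumr.
rewrite [RHS]exchange_big /=; apply: eq_bigr => S _.
under [RHS]eq_bigr do rewrite scaler_sumr.
rewrite [RHS]exchange_big /=; apply: eq_bigr => T _.
under [RHS]eq_bigr do rewrite scalerA mulrA.
rewrite -scaler_suml -mulr_suml; congr ((_ * _) *: _).
by rewrite sum_ffunE; apply: eq_bigr => i _; rewrite !ffunE.
Qed.

Fact wedge_vec_linear v : linear (wedge (ext_vec v)).
Proof.
move=> a x y; rewrite !wedge_vecE scaler_sumr -big_split /=.
by apply: eq_bigr => i _; rewrite linearP /= scalerDr !scalerA mulrC.
Qed.
HB.instance Definition _ v :=
  GRing.isLinear.Build F ext ext *:%R (wedge (ext_vec v)) (wedge_vec_linear v).

Fact wedge_vecB u v x :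
  wedge (ext_vec (u - v)) x = wedge (ext_vec u) x - wedge (ext_vec v) x.
Proof.
rewrite !wedge_vecE -sumrB.
by apply: eq_bigr => i _; rewrite !mxE scalerBl.
Qed.

Lemma ext_vec_delta i : ext_vec (delta_mx i 0) = bvec F [set i].
Proof.
rewrite /ext_vec (bigD1 i) //= mxE !eqxx scale1r big1 ?addr0 // => j /negPf ne.
by rewrite mxE ne scale0r.
Qed.

Definition second_quant (A : 'M[F]_n) (x : ext) : ext :=
  \sum_i \sum_j A i j *: creation i (annihilation j x).

Fact second_quant_linear A : linear (second_quant A).
Proof.
move=> a x y; rewrite /second_quant scaler_sumr -big_split /=.
apply: eq_bigr => i _; rewrite scaler_sumr -big_split /=.
apply: eq_bigr => j _; do 2!rewrite linearP /=.
by rewrite scalerDr !scalerA mulrC.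
Qed.
HB.instance Definition _ A :=
  GRing.isLinear.Build F ext ext *:%R (second_quant A) (second_quant_linear A).

Lemma second_quant1 A : second_quant A ext1 = 0.
Proof.
apply: big1 => i _; apply: big1 => j _.
rewrite [annihilation _ _](_ : _ = 0) ?linear0 ?scaler0 //.
apply/ffunP => T; rewrite !ffunE; case: ifP => // _.
have /negPf -> : j |: T != set0 by apply/set0Pn; exists j; rewrite setU11.
by rewrite mulr0.
Qed.

Lemma second_quant_wedge A v x :
  second_quant A (wedge (ext_vec v) x)
    = wedge (ext_vec (A *m v)) x + wedge (ext_vec v) (second_quant A x).
Proof.
have key l : second_quant A (creation l x)
    = \sum_i A i l *: creation i x + creation l (second_quant A x).
  rewrite /second_quant linear_sum -big_split /=; apply: eq_bigr => i _.
  rewrite linear_sum /= [X in X + _](_ : _ =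
     \sum_j A i j *: creation i ((j == l)%:R *: x)).
    rewrite -big_split /=; apply: eq_bigr => j _.
    rewrite [creation l (_ *: _)]linearZ /= -scalerDr; congr (_ *: _).
    by rewrite -annihilation_creation linearD /= [in RHS]creationC addrNK.
  rewrite (bigD1 l) //= eqxx scale1r big1 ?addr0 // => j /negPf ->.
  by rewrite scale0r linear0 scaler0.
rewrite !wedge_vecE linear_sum /=.
under eq_bigr do rewrite linearZ /= key scalerDr.
rewrite big_split /=; congr (_ + _).
under eq_bigr do rewrite scaler_sumr.
rewrite exchange_big /=; apply: eq_bigr => i _.
rewrite mxE scaler_suml; apply: eq_bigr => j _.
by rewrite scalerA mulrC.
Qed.

Lemma second_quant_bigwedge A (w : 'I_n -> 'cV[F]_n) (s : seq 'I_n) : uniq s ->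
  second_quant A (\big[wedge/ext1]_(i <- s) ext_vec (w i))
    = \sum_(j <- s) \big[wedge/ext1]_(i <- s)
        ext_vec (if i == j then A *m w i else w i).
Proof.
elim: s => [|a s IH]; first by rewrite !big_nil second_quant1.
case/andP=> aNs /IH {}IH; rewrite !big_cons second_quant_wedge IH eqxx.
congr (_ + _).
  congr (wedge _ _); rewrite [LHS]big_seq [RHS]big_seq; apply: eq_bigr => i si.
  by case: eqP => // e; rewrite -e si in aNs.
rewrite linear_sum /= [LHS]big_seq [RHS]big_seq; apply: eq_bigr => j sj.
rewrite big_cons; case: eqP => // e.
by rewrite e sj in aNs.
Qed.

Lemma bigwedge_sorted (s : seq 'I_n) : sorted (fun i j : 'I_n => i < j)%N s ->
  \big[wedge/ext1]_(i <- s) ext_vec (delta_mx i 0) = bvec F [set i in s].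
Proof.
elim: s => [_|a s IH]; first by rewrite big_nil set_nil.
rewrite /= path_sortedE; last by move=> ? ? ?; apply: ltn_trans.
case/andP=> /allP as_ /IH {}IH; rewrite big_cons IH ext_vec_delta wedge1E.
rewrite creation_bvec inE; case: ifP => [/as_|aNs]; first by rewrite ltnn.
rewrite (_ : before [set i in s] a = 0%N) ?scale1r; first by rewrite set_cons.
apply: eq_card0 => b; rewrite !inE; apply/negP => /andP[/as_ ab ba].
by have := ltn_trans ab ba; rewrite ltnn.
Qed.

Lemma bvec_bigwedge (S : {set 'I_n}) :
  bvec F S = \big[wedge/ext1]_(i <- enum S) ext_vec (delta_mx i 0).
Proof.
rewrite bigwedge_sorted; first by congr bvec; apply/setP=> i; rewrite inE mem_enum.
rewrite /enum_mem; apply: sorted_filter; first by move=> ? ? ?; apply: ltn_trans.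
have : sorted ltn (map val (enum 'I_n)) by rewrite val_enum_ord iota_ltn_sorted.
by rewrite sorted_map enumT.
Qed.

Lemma ext_actE A : ext_act A =1 second_quant A.
Proof.
move=> x; rewrite {2}(coordE x) linear_sum; apply: eq_bigr => S _.
rewrite linearZ /= bvec_bigwedge second_quant_bigwedge ?enum_uniq //.
by rewrite big_enum.
Qed.

Fact ext_act_linear A : linear (ext_act A).
Proof. by move=> a x y; rewrite !ext_actE linearP. Qed.

Fact ext_act_linearl x : linear (ext_act^~ x).
Proof.
move=> a A B; rewrite !ext_actE /second_quant scaler_sumr -big_split /=.
apply: eq_bigr => i _; rewrite scaler_sumr -big_split /=.
by apply: eq_bigr => j _; rewrite !mxE scalerDl scalerA.
Qed.

Lemma ext_act_bigwedge A (w : 'I_n -> 'cV[F]_n) (s : seq 'I_n) : uniq s ->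
  ext_act A (\big[wedge/ext1]_(i <- s) ext_vec (w i))
    = \sum_(j <- s) \big[wedge/ext1]_(i <- s)
        ext_vec (if i == j then A *m w i else w i).
Proof. by move=> us; rewrite ext_actE second_quant_bigwedge. Qed.

Fact ext_act_bracket A B x :
  ext_act (A *m B - B *m A) x
    = ext_act A (ext_act B x) - ext_act B (ext_act A x).
Proof.
pose D := second_quant; rewrite !ext_actE.
suff H S : D (A *m B - B *m A) (bvec F S)
    = D A (D B (bvec F S)) - D B (D A (bvec F S)).
  have dec A' B' : D A' (D B' x) = \sum_S x S *: D A' (D B' (bvec F S)).
    rewrite /D {1}(coordE x) (linear_sum (second_quant B')).
    rewrite (linear_sum (second_quant A')); apply: eq_bigr => S _.
    by rewrite (linearZ_LR (second_quant B')) (linearZ_LR (second_quant A')).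
  rewrite -!/(D _ _) !dec {1}(coordE x) /D (linear_sum (second_quant _)) -sumrB.
  apply: eq_bigr => S _; rewrite linearZ_LR -scalerBr; congr (_ *: _); exact: H.
rewrite bvec_bigwedge; elim: (enum S) => [|i s IH].
  by rewrite big_nil /D !second_quant1 !(linear0 (second_quant _)) subrr.
rewrite big_cons; set v := delta_mx _ _; set y := \big[_/_]_(_ <- _) _ in IH *.
rewrite /D !second_quant_wedge !linearD /= !second_quant_wedge -!/(D _ _) IH.
rewrite mulmxBl wedge_vecB linearB /= !mulmxA !opprD !addrA.
by rewrite [RHS](ACl ((1*5*4*8)*(2*7)*(3*6))) /= !subrr !addr0.
Qed.

Definition ext_rep : glRep F n :=
  GlRep ext_act_linear ext_act_linearl ext_act_bracket.

End Exterior.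

(** The basis of the k-th tensor power is indexed by the functions f from 'I_k
    to the basis of W, standing for e_(f 0) (x) ... (x) e_(f (k-1)). *)

Section TensorPower.
Variables (F : fieldType) (n : nat) (W : glRep F n) (k : nat).
Local Notation I := (rep_idx W).
Local Notation tpow := (coord F {ffun 'I_k -> I}).

Definition tens (x : 'I_k -> coord F I) : tpow :=
  [ffun f : {ffun 'I_k -> I} => \prod_(p < k) (x p (f p) : F)].

(** A (x_1 (x) ... (x) x_k) = \sum_p x_1 (x) ... (x) A x_p (x) ... (x) x_k,
    extended linearly from the basis. *)
Definition tens_act (A : 'M[F]_n) (t : tpow) : tpow :=
  \sum_f t f *: \sum_(p < k)
    tens (fun r => if r == p then rep_act A (bvec F (f r)) else bvec F (f r)).

Lemma eq_tens x y : x =1 y -> tens x = tens y.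
Proof. by move=> e; apply/ffunP => f; rewrite !ffunE; under eq_bigr do rewrite e. Qed.

Lemma tens_expand (x : 'I_k -> coord F I) (z : 'I_k -> I -> coord F I) :
  tens (fun q => \sum_i x q i *: z q i)
    = \sum_(f : {ffun 'I_k -> I}) (\prod_q x q (f q)) *: tens (fun q => z q (f q)).
Proof.
apply/ffunP => g; rewrite sum_ffunE ffunE.
under eq_bigr do rewrite sum_ffunE.
rewrite bigA_distr_bigA /=; apply: eq_bigr => f _.
rewrite !ffunE /GRing.scale /= -big_split /=.
by apply: eq_bigr => q _; rewrite ffunE.
Qed.

Lemma bvec_tens (f : {ffun 'I_k -> I}) : bvec F f = tens (fun q => bvec F (f q)).
Proof.
apply/ffunP => g; rewrite !ffunE; case: eqP => [->|ne].
  by rewrite big1 // => q _; rewrite ffunE eqxx.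
have [q gq] : exists q, g q != f q.
  apply/existsP; apply: contraT; rewrite negb_exists => /forallP e.
  by case: ne; apply/ffunP => q; apply/eqP; have := e q; rewrite negbK.
by rewrite (bigD1 q) //= ffunE (negPf gq) mul0r.
Qed.

Lemma tens_slot p a (x y z : 'I_k -> coord F I) :
  tens (fun q => if q == p then a *: y q + z q else x q)
    = a *: tens (fun q => if q == p then y q else x q)
      + tens (fun q => if q == p then z q else x q).
Proof.
apply/ffunP => f; rewrite !ffunE !(bigD1 p (P := xpredT)) //= !eqxx.
have e u : \prod_(i < k | i != p) ((if i == p then u i else x i) (f i) : F)
    = \prod_(i < k | i != p) x i (f i).
  by apply: eq_bigr => i /negPf ->.
by rewrite !e !ffunE mulrDl /GRing.scale /= mulrA.
Qed.

Lemma tens_slotB p (x y z : 'I_k -> coord F I) :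
  tens (fun q => if q == p then y q - z q else x q)
    = tens (fun q => if q == p then y q else x q)
      - tens (fun q => if q == p then z q else x q).
Proof.
rewrite -scaleN1r addrC -tens_slot; apply: eq_tens => q.
by rewrite scaleN1r addrC.
Qed.

Lemma tens_act_tens A x :
  tens_act A (tens x)
    = \sum_p tens (fun q => if q == p then rep_act A (x q) else x q).
Proof.
rewrite /tens_act; under eq_bigr do rewrite scaler_sumr.
rewrite exchange_big /=; apply: eq_bigr => p _.
pose z q i := if q == p then rep_act A (bvec F i) else bvec F i : coord F I.
transitivity (tens (fun q => \sum_i x q i *: z q i)).
  by rewrite tens_expand; apply: eq_bigr => f _; rewrite ffunE.
apply: eq_tens => q; rewrite /z; case: ifP => _; last by rewrite -coordE.
rewrite {2}(coordE (x q)) linear_sum.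
by apply: eq_bigr => i _; rewrite linearZ.
Qed.

Fact tens_act_linear A : linear (tens_act A).
Proof.
move=> a x y; rewrite /tens_act scaler_sumr -big_split /=.
by apply: eq_bigr => f _; rewrite !ffunE scalerDl scalerA.
Qed.
HB.instance Definition _ A :=
  GRing.isLinear.Build F tpow tpow *:%R (tens_act A) (tens_act_linear A).

Fact tens_act_linearl t : linear (tens_act^~ t).
Proof.
move=> a A B; rewrite /tens_act scaler_sumr -big_split /=.
apply: eq_bigr => f _; rewrite scalerA mulrC -scalerA -scalerDr; congr (_ *: _).
rewrite scaler_sumr -big_split /=; apply: eq_bigr => p _.
rewrite -tens_slot; apply: eq_tens => q; case: ifP => // _.
exact: rep_linearl.
Qed.

Fact tens_act_bracket A B t :
  tens_act (A *m B - B *m A) t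
    = tens_act A (tens_act B t) - tens_act B (tens_act A t).
Proof.
suff H (f : {ffun 'I_k -> I}) : tens_act (A *m B - B *m A) (bvec F f)
    = tens_act A (tens_act B (bvec F f)) - tens_act B (tens_act A (bvec F f)).
  have dec A' B' : tens_act A' (tens_act B' t)
      = \sum_f t f *: tens_act A' (tens_act B' (bvec F f)).
    rewrite {1}(coordE t) (linear_sum (tens_act B')).
    rewrite (linear_sum (tens_act A')); apply: eq_bigr => f _.
    by rewrite (linearZ_LR (tens_act B')) (linearZ_LR (tens_act A')).
  rewrite !dec {1}(coordE t) (linear_sum (tens_act _)) -sumrB.
  apply: eq_bigr => f _; rewrite (linearZ_LR (tens_act _)) -scalerBr.
  by congr (_ *: _); apply: H.
rewrite bvec_tens; move: (fun q : 'I_k => bvec F (f q)) => x.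
have act2 A' B' : tens_act A' (tens_act B' (tens x))
    = \sum_p \sum_r tens (fun q =>
        if q == r then rep_act A' (if q == p then rep_act B' (x q) else x q)
        else if q == p then rep_act B' (x q) else x q).
  rewrite tens_act_tens (linear_sum (tens_act A')).
  by apply: eq_bigr => p _; rewrite /= tens_act_tens.
rewrite !act2 tens_act_tens [X in _ = _ - X]exchange_big -sumrB.
apply: eq_bigr => p _ /=.
rewrite -sumrB (bigD1 p) //= [X in _ = _ + X]big1 ?addr0 => [|r /negPf rp].
  transitivity (tens (fun q => if q == p then
      rep_act A (rep_act B (x q)) - rep_act B (rep_act A (x q)) else x q)).
    by apply: eq_tens => q; rewrite rep_bracket.
  by rewrite tens_slotB; congr (_ - _); apply: eq_tens => q; case: ifP.
apply/eqP; rewrite subr_eq0; apply/eqP; apply: eq_tens => q.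
by case: (eqVneq q p) => [->|_]; rewrite ?(eq_sym p) ?rp.
Qed.

Definition tens_rep : glRep F n :=
  GlRep tens_act_linear tens_act_linearl tens_act_bracket.

End TensorPower.

(* Main.v *)
From HB Require Import structures.
Require Import Defs.
From mathcomp Require Import all_boot all_order all_algebra.
From mathcomp Require Import fingroup perm zify ring.
From mathcomp Require Import boolp reals.
From mathcomp Require Import complex.

(** Idea. Up to a factor depending on the row and one depending on the column,
    row i of the determinant (rows and columns reversed) is a monic polynomial
    of degree i in [k + n - 1 - a_j]_q, so the determinant is a Vandermonde
    determinant. The numbers a_i and the reversed beta-numbers of the conjugate
    partition are complementary subsets of the interval [0, n + k - 1], which
    turns the product into the q-dimension for gl_k. Expanding all columns by
    the q-Pascal rule gives a recursion on k with coefficients in N[q]: a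
    nonnegative polynomial, which at q = 1 counts the words of k row sets whose
    prefixes all have dominant weight.

    The tensor power carries a Hermitian form for which E_ij and E_ji are
    adjoint. Hence it is completely reducible, an irreducible subrepresentation
    contains at most one highest weight line, and the multiplicity of V(la) is
    the dimension of the space of highest weight vectors of weight la. This
    dimension is the above number of words. At most: the leading word of a
    highest weight vector has dominant prefixes, because fixing the last slots
    to their leading values leaves a highest weight vector of the first slots.
    At least: antisymmetrizing such a word along the columns of the diagram
    gives a highest weight vector led by that word. *)

Set Implicit Arguments.
Unset Strict Implicit.
Unset Printing Implicit Defensive.

Import Order.TTheory GRing.Theory Num.Theory.
Local Open Scope ring_scope.

(** * Determinants and q-numbers *)

Lemma det_scale (K : comPzRingType) (n : nat) (r c : 'I_n -> K) (M : 'M[K]_n) :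
  \det (\matrix_(i, j) (r i * c j * M i j))
    = (\prod_i r i) * (\prod_j c j) * \det M.
Proof.
have -> : \matrix_(i, j) (r i * c j * M i j)
    = diag_mx (\row_i r i) *m M *m diag_mx (\row_j c j).
  apply/matrixP => i j; rewrite mul_mx_diag mul_diag_mx !mxE; ring.
rewrite !det_mulmx !det_diag.
under eq_bigr do rewrite mxE.
under [X in _ * X = _]eq_bigr do rewrite mxE.
ring.
Qed.

(** Rows and columns undergo the same permutation, so the two signs cancel. *)
Lemma det_rev (K : comPzRingType) (n : nat) (M : 'M[K]_n) :
  \det (\matrix_(i, j) M (rev_ord i) (rev_ord j)) = \det M.
Proof.
pose s : 'S_n := perm (@rev_ord_inj n).
have -> : \matrix_(i, j) M (rev_ord i) (rev_ord j) = row_perm s (col_perm s M).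
  by apply/matrixP => i j; rewrite !mxE !permE.
rewrite row_permE col_permE !det_mulmx !det_perm odd_permV.
by rewrite mulrCA -expr2 sqrr_sign mulr1.
Qed.

(* Unitriangular row operations turn the matrix p_i(y_j) into a Vandermonde
   matrix. *)
Lemma det_horner_monic (K : comNzRingType) (n : nat) (p : 'I_n -> {poly K})
    (y : 'I_n -> K) :
  (forall i, p i \is monic) -> (forall i, size (p i) = i.+1) ->
  \det (\matrix_(i, j) (p i).[y j])
    = \prod_(i < n) \prod_(j < n | (i < j)%N) (y j - y i).
Proof.
move=> mon sz.
have -> : \matrix_(i, j) (p i).[y j]
    = (\matrix_(i, l) (p i)`_l) *m Vandermonde n (\row_j y j).
  apply/matrixP => i j; rewrite !mxE (@horner_coef_wide _ n) ?sz //.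
  by apply: eq_bigr => l _; rewrite !mxE.
rewrite det_mulmx det_Vandermonde det_trig; last first.
  by apply/is_trig_mxP => i j ij; rewrite mxE nth_default ?sz.
rewrite big1 ?mul1r => [|i _]; last first.
  by rewrite mxE; have /monicP := mon i; rewrite lead_coefE sz.
by apply: eq_bigr => i _; apply: eq_bigr => j _; rewrite !mxE.
Qed.

Section QNumbers.
Variables (K : fieldType) (q : K).
(** This holds for an indeterminate q and for q = 1 in characteristic zero, the two cases to which
    the section is applied. *)
Hypothesis qint_neq0 : forall m, qint q m.+1 != 0.
Hypothesis q_neq0 : q != 0.

Lemma qint0 : qint q 0 = 0.
Proof. by rewrite /qint big_ord0. Qed.

Lemma qintD m d : qint q (m + d) = qint q m + q ^+ m * qint q d.
Proof.
rewrite /qint big_split_ord /= mulr_sumr; congr (_ + _).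
by apply: eq_bigr => i _; rewrite exprD.
Qed.

Lemma qintB m d : (d <= m)%N -> qint q (m - d) = q ^- d * (qint q m - qint q d).
Proof.
move=> dm; rewrite -{2}(subnKC dm) qintD addrAC subrr add0r mulrA mulVf ?mul1r //.
exact: expf_neq0.
Qed.

Lemma qfact0 : qfact q 0 = 1.
Proof. by rewrite /qfact big_geq. Qed.

Lemma qfactS m : qfact q m.+1 = qfact q m * qint q m.+1.
Proof. by rewrite /qfact big_nat_recr. Qed.

Lemma qfact_neq0 m : qfact q m != 0.
Proof.
by elim: m => [|m IH]; rewrite ?qfact0 ?oner_eq0 // qfactS mulf_neq0.
Qed.

Lemma qbinom_small a b : (a < b)%N -> qbinom q a b = 0.
Proof. by rewrite /qbinom ltnNge => /negPf ->. Qed.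

Lemma qbinomn0 a : qbinom q a 0 = 1.
Proof. by rewrite /qbinom qfact0 mul1r subn0 divff ?qfact_neq0. Qed.

Lemma qbinomnn a : qbinom q a a = 1.
Proof. by rewrite /qbinom leqnn subnn qfact0 mulr1 divff ?qfact_neq0. Qed.

Lemma qbinomS m a :
  qbinom q m.+1 a.+1 = q ^+ a.+1 * qbinom q m a.+1 + qbinom q m a.
Proof.
case: (ltngtP a m) => [am|ma|->].
- rewrite /qbinom ltnS am ltnW // subSS.
  rewrite -(subnSK am) !qfactS (subnSK am).
  have e : qint q m.+1 = qint q a.+1 + q ^+ a.+1 * qint q (m - a).
    by rewrite -qintD; congr qint; lia.
  rewrite e.
  have ? := qint_neq0 a; have ? := qfact_neq0 a; have ? := qfact_neq0 (m - a.+1).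
  have ? : qint q (m - a) != 0 by rewrite -(subnSK am).
  by field; do !(apply/andP; split).
- by rewrite !qbinom_small ?mulr0 ?addr0 // ltnW.
- by rewrite !qbinomnn qbinom_small ?ltnSn // mulr0 add0r.
Qed.

(** Lowering the upper index from m + 1 to m multiplies by [m+1-a] / [m+1]. This separates a row
    factor, a column factor and a product of i factors depending on N - a. When a exceeds N - i both
    sides vanish, because the product then contains [0]. *)
Lemma qbinom_lower N i a : (a <= N)%N -> (i <= N)%N ->
  qbinom q (N - i) a = qfact q (N - i) / (qfact q a * qfact q (N - a))
    * \prod_(d < i) qint q (N - a - d).
Proof.
move=> aN; elim: i => [|i IH] iN.
  by rewrite big_ord0 mulr1 subn0 /qbinom aN.
have step m b : qbinom q m b = qbinom q m.+1 b * (qint q (m.+1 - b) / qint q m.+1).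
  case: (ltngtP b m.+1) => [bm|mb|->].
  - rewrite /qbinom -ltnS bm (ltnW bm) (subSn (_ : b <= m)%N) // !qfactS.
    have ? := qint_neq0 m; have ? := qfact_neq0 b.
    have ? := qfact_neq0 (m - b); have ? := qint_neq0 (m - b).
    by field; do !(apply/andP; split).
  - by rewrite !qbinom_small ?mul0r // ltnW.
  - by rewrite subnn qint0 mul0r mulr0 qbinom_small.
rewrite step subnSK // IH ?(ltnW iN) // big_ord_recr /= -(subnSK iN) qfactS.
rewrite (subnSK iN) -[in qint q (N - i - a)]subnDA addnC subnDA.
have ? : qint q (N - i) != 0 by rewrite -(subnSK iN).
have ? := qfact_neq0 a; have ? := qfact_neq0 (N - a).
by field; do !(apply/andP; split).
Qed.

(** Each factor is [c-d] = q^-d ([c] - [d]). For c < d the truncated subtraction breaks this, but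
    then both products vanish at the index d = c. *)
Lemma prod_qintB c i :
  \prod_(d < i) qint q (c - d)
    = \prod_(d < i) q ^- d * (\prod_(d < i) ('X - (qint q d)%:P)).[qint q c].
Proof.
rewrite horner_prod -big_split /=.
case: (leqP i c) => [ic|ci].
  by apply: eq_bigr => d _; rewrite hornerXsubC qintB //; have := ltn_ord d; lia.
rewrite (bigD1 (Ordinal ci)) //= subnn qint0 mul0r.
by rewrite (bigD1 (Ordinal ci)) //= hornerXsubC subrr mulr0 mul0r.
Qed.

(** The lower indices are arbitrary naturals, one for each column, so that the q-Pascal recursion
    can decrease them separately. *)
Definition qdet (n k : nat) (a : 'I_n -> nat) : K :=
  \det (\matrix_(i, j) qbinom q (k + rev_ord i) (a j)).

(** This is the number a_(j+1) of the theorem, with indices starting at 0. *)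
Definition beta_set (n : nat) (la : seq nat) (j : 'I_n) : nat :=
  (part la j.+1 + rev_ord j)%N.

Lemma MA_qdet n k la : MA q n k la = qdet k (@beta_set n la).
Proof.
rewrite /MA -det_rev; congr (\det _); apply/matrixP => i j; rewrite !mxE.
by congr (qbinom _ _ _); rewrite /beta_set /= addnC subKn.
Qed.

(** The negative powers of q from [prod_qintB] are cleared into the product on the left. With N = k
    + n - 1, each Vandermonde difference is [N-a_j] - [N-a_i] = q^(N-a_i) [a_i-a_j]. *)
Lemma qdet_prod n k (a : 'I_n -> nat) :
  (forall j, a j <= k + n.-1)%N ->
  (forall i j : 'I_n, (i < j)%N -> (a j <= a i)%N) ->
  qdet k a * \prod_(i < n) \prod_(d < i) q ^+ d
    = (\prod_(i < n) q ^+ ((k + n.-1 - a i) * (n - i.+1)))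
      * ((\prod_(i < n) qfact q (k + i))
         * (\prod_(i < n) \prod_(j < n | (i < j)%N) qint q (a i - a j))
         / \prod_(i < n) (qfact q (a i) * qfact q (k + n.-1 - a i))).
Proof.
move=> aN adec; set N := (k + n.-1)%N.
pose p (i : 'I_n) : {poly K} := \prod_(d < i) ('X - (qint q d)%:P).
pose y (j : 'I_n) := qint q (N - a j).
have -> : qdet k a = \det (\matrix_(i, j)
    ((qfact q (k + rev_ord i) * \prod_(d < i) q ^- d)
       * (qfact q (a j) * qfact q (N - a j))^-1
       * (\matrix_(i, j) (p i).[y j]) i j)).
  congr (\det _); apply/matrixP => i j; rewrite !mxE.
  have e : (k + rev_ord i = N - i)%N.
    by rewrite /= /N; have := ltn_ord i; lia.
  rewrite e qbinom_lower ?aN //; last by have := ltn_ord i; rewrite /N; lia.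
  by rewrite prod_qintB /p /y -!mulrA; congr (_ * _); rewrite mulrCA.
rewrite det_scale det_horner_monic; first last.
- by move=> i; rewrite /p size_prod_XsubC /index_enum -enumT size_enum_ord.
- by move=> i; apply: monic_prod_XsubC.
have -> : \prod_(i < n) \prod_(j < n | (i < j)%N) (y j - y i)
   = (\prod_(i < n) q ^+ ((N - a i) * (n - i.+1)))
     * \prod_(i < n) \prod_(j < n | (i < j)%N) qint q (a i - a j).
  rewrite -big_split /=; apply: eq_bigr => i _.
  rewrite exprM -[(n - i.+1)%N](_ : #|[pred j : 'I_n | (i < j)%N]| = _).
    rewrite -prodr_const -big_split /=; apply: eq_bigr => j ij.
    rewrite /y (_ : (N - a j = N - a i + (a i - a j))%N) ?qintD; first by ring.
    by have := aN i; have := adec _ _ ij; rewrite /N; lia.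
  rewrite -sum1_card (reindex_inj rev_ord_inj) /=.
  rewrite (eq_bigl (fun j : 'I_n => (j < n - i.+1)%N)); last first.
    by move=> j /=; rewrite !inE /=; have := ltn_ord j; lia.
  rewrite -(big_ord_widen n (fun=> 1%N)) ?leq_subr //.
  by rewrite sum1_card card_ord.
have -> : \prod_(i < n) qfact q (k + i) = \prod_(i < n) qfact q (k + rev_ord i).
  by rewrite (reindex_inj rev_ord_inj).
rewrite big_split /= prodfV; set A := \prod_i qfact _ _; set B := \prod_(i < n) \prod_(d < i) q ^- d.
set C := \prod_(i < n) \prod_(d < i) q ^+ d.
have BC : B * C = 1.
  rewrite /B /C -big_split /= big1 // => i _; rewrite -big_split /= big1 // => d _.
  by rewrite mulVf // expf_neq0.
set D := (\prod_i _)^-1; set E := \prod_i q ^+ _; set G := \prod_i \prod_(_ < n | _) _.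
transitivity (A * D * E * G * (B * C)); first by ring.
by rewrite BC; ring.
Qed.

Lemma qfact_prod m : qfact q m = \prod_(d < m) qint q d.+1.
Proof. by rewrite /qfact big_add1 big_mkord. Qed.

Lemma qfact_rev m : qfact q m = \prod_(d < m) qint q (m - d).
Proof.
rewrite qfact_prod (reindex_inj rev_ord_inj) /=.
by apply: eq_bigr => d _; congr qint; have := ltn_ord d; lia.
Qed.

Lemma prod_qint_pairs N :
  \prod_(x < N) \prod_(y < N | (x < y)%N) qint q (y - x) = \prod_(x < N) qfact q x.
Proof.
rewrite (exchange_big_dep xpredT) //=; apply: eq_bigr => y _.
rewrite qfact_rev.
by rewrite (big_ord_widen N (fun x => qint q (y - x))) // ltnW.
Qed.

Section Complement.
Variable N : nat.
(** The factor 1 for pairs that are not increasing lets products run over full rectangles of pairs,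
    which can be cut freely along S and its complement. *)
Let h (x y : 'I_N) : K := if (x < y)%N then qint q (y - x) else 1.
Let Delta (S : {set 'I_N}) : K := \prod_(x in S) \prod_(y in S) h x y.

Lemma prod_qint_around (x : 'I_N) :
  \prod_y (h x y * h y x) = qfact q x * qfact q (N.-1 - x).
Proof.
rewrite big_split /= mulrC /h -!big_mkcond /=; congr (_ * _).
  by rewrite qfact_rev (big_ord_widen N (fun y => qint q (x - y))) // ltnW.
rewrite -(big_geq_mkord _ _ xpredT (fun y => qint q (y - x))) -[x.+1]add0n big_addn.
rewrite big_mkord qfact_prod (_ : (N.-1 - x = N - x.+1)%N); last by lia.
apply: eq_bigr => d _; congr qint; lia.
Qed.

(** The product over all pairs in [0, N-1] is [Delta S] times the mixed pairs times [Delta (~: S)].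
    By [prod_qint_around] the product over x in S of the distances to all other points is [Delta S]
    squared times the same mixed pairs. Comparing the two eliminates the mixed pairs. *)
Lemma Delta_setC (S : {set 'I_N}) :
  Delta (~: S) * \prod_(x in S) (qfact q x * qfact q (N.-1 - x))
    = \prod_(x < N) qfact q x * Delta S.
Proof.
have -> : \prod_(x in S) (qfact q x * qfact q (N.-1 - x)) =
    (Delta S * \prod_(x in S) \prod_(y in ~: S) h x y)
    * (Delta S * \prod_(x in ~: S) \prod_(y in S) h x y).
  rewrite [X in _ = _ * (Delta S * X)]exchange_big.
  rewrite /Delta [X in _ = _ * (X * _)]exchange_big -!big_split /=.
  apply: eq_bigr => x xS; rewrite -prod_qint_around big_split /=.
  rewrite (bigID [in S]) [X in _ * X](bigID [in S]) /=.
  by congr (_ * _ * (_ * _)); apply: eq_bigl => y; rewrite inE.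
have -> : \prod_(x < N) qfact q x =
    (Delta S * \prod_(x in S) \prod_(y in ~: S) h x y)
    * (\prod_(x in ~: S) \prod_(y in S) h x y * Delta (~: S)).
  rewrite -prod_qint_pairs.
  under [LHS]eq_bigr => x _ do rewrite big_mkcond -/(h x _).
  rewrite (bigID [in S]) /=; congr (_ * _).
    rewrite -big_split; apply: eq_bigr => x _; rewrite (bigID [in S]) /=.
    by congr (_ * _); apply: eq_bigl => y; rewrite inE.
  rewrite -big_split; apply: eq_big => x; first by rewrite inE.
  move=> _; rewrite (bigID [in S]) /=.
  by congr (_ * _); apply: eq_bigl => y; rewrite inE.
ring.
Qed.

Lemma Delta_imset n (f : 'I_n -> 'I_N) : injective f ->
  Delta (f @: 'I_n) = \prod_i \prod_j h (f i) (f j).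
Proof.
move=> finj; rewrite /Delta big_imset /=; last by move=> ? ? _ _; apply: finj.
by apply: eq_bigr => i _; rewrite big_imset //= => ? ? _ _; apply: finj.
Qed.

Lemma Delta_incr n (f : 'I_n -> 'I_N) :
    (forall i j : 'I_n, (i < j)%N = (f i < f j)%N) -> injective f ->
  Delta (f @: 'I_n) = \prod_(i < n) \prod_(j < n | (i < j)%N) qint q (f j - f i).
Proof.
move=> fm finj; rewrite Delta_imset //; apply: eq_bigr => i _.
by rewrite /h -big_mkcond; apply: eq_bigl => j; rewrite -fm.
Qed.

Lemma Delta_decr n (f : 'I_n -> 'I_N) :
    (forall i j : 'I_n, (i < j)%N = (f j < f i)%N) -> injective f ->
  Delta (f @: 'I_n) = \prod_(i < n) \prod_(j < n | (i < j)%N) qint q (f i - f j).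
Proof.
move=> fm finj; rewrite Delta_imset // exchange_big; apply: eq_bigr => i _ /=.
by rewrite /h -big_mkcond; apply: eq_bigl => j; rewrite -fm.
Qed.

End Complement.

(** The quotient in the theorem without its power of q, as a function of the beta-numbers. *)
Definition qhook n k (a : 'I_n -> nat) : K :=
  (\prod_(i < n) qfact q (k + i))
    * (\prod_(i < n) \prod_(j < n | (i < j)%N) qint q (a i - a j))
    / \prod_(i < n) (qfact q (a i) * qfact q (k + n.-1 - a i)).

Lemma eq_qhook n k (a b : 'I_n -> nat) : a =1 b -> qhook k a = qhook k b.
Proof.
move=> ab; rewrite /qhook; congr (_ * _ / _); apply: eq_bigr => i _.
  by apply: eq_bigr => j _; rewrite !ab.
by rewrite ab.
Qed.

(** The reflection of the interval [0, k + n - 1] preserves distances and swaps the two factorials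
    in each factor of the denominator. On beta-numbers it is the passage to the complementary
    partition. *)
Lemma qhook_rev n k (a : 'I_n -> nat) : (forall j, a j <= k + n.-1)%N ->
  qhook k (fun i => (k + n.-1 - a (rev_ord i))%N) = qhook k a.
Proof.
move=> aN; rewrite /qhook; congr (_ * _ / _).
  rewrite (reindex_inj rev_ord_inj) /=.
  under eq_bigr do rewrite (reindex_inj rev_ord_inj) /=.
  rewrite (exchange_big_dep xpredT) //=; apply: eq_bigr => i _.
  apply: eq_big => j; first by have := ltn_ord i; have := ltn_ord j; lia.
  by move=> _; rewrite !rev_ordK; congr qint; have := aN i; have := aN j; lia.
rewrite (reindex_inj rev_ord_inj) /=; apply: eq_bigr => i _.
by rewrite rev_ordK subKn // mulrC.
Qed.

(* The beta-numbers of a partition in the n x k rectangle and the reversed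
   beta-numbers of its conjugate partition the interval [0, n + k - 1]. *)
Lemma qhook_complement n k (a : 'I_n -> nat) (b : 'I_k -> nat) :
  (forall i, a i < k + n)%N -> (forall j, b j < k + n)%N ->
  (forall i i' : 'I_n, (i < i')%N -> (a i' < a i)%N) ->
  (forall j j' : 'I_k, (j < j')%N -> (b j < b j')%N) ->
  (forall i j, a i != b j) ->
  \prod_(i < k) \prod_(j < k | (i < j)%N) (qint q (b j - b i) / qint q (j - i))
    = qhook k a.
Proof.
move=> aN bN amon bmon ab.
pose f i : 'I_(k + n) := Ordinal (aN i); pose g j : 'I_(k + n) := Ordinal (bN j).
have fm (i i' : 'I_n) : (i < i')%N = (f i' < f i)%N.
  case: (ltngtP i i') => [/amon //|/amon /=|/ord_inj ->]; last by rewrite ltnn.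
  by move=> lt; rewrite ltnNge ltnW.
have gm (i i' : 'I_k) : (i < i')%N = (g i < g i')%N.
  case: (ltngtP i i') => [/bmon //|/bmon /=|/ord_inj ->]; last by rewrite ltnn.
  by move=> lt; rewrite ltnNge ltnW.
have finj : injective f.
  move=> i i' e; apply: ord_inj; case: (ltngtP i i') => //; rewrite fm e ltnn //.
have ginj : injective g.
  move=> i i' e; apply: ord_inj; case: (ltngtP i i') => //; rewrite gm e ltnn //.
(* The two images are disjoint and their sizes add up to k + n. *)
have gE : g @: 'I_k = ~: (f @: 'I_n).
  apply/eqP; rewrite eqEcard; apply/andP; split.
    apply/subsetP => _ /imsetP[j _ ->]; rewrite inE; apply/imsetP => -[i _].
    by move/(congr1 val) => /= e; have := ab i j; rewrite -e eqxx.
  rewrite cardsCs setCK !card_imset // !card_ord; lia.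
have := Delta_setC (f @: 'I_n); rewrite -gE Delta_incr // Delta_decr //=.
rewrite big_imset /=; last by move=> ? ? _ _; apply: finj.
rewrite big_split_ord /= => H.
under eq_bigr do rewrite big_split /=.
rewrite big_split /= /qhook.
have -> : \prod_(i < k) \prod_(j < k | (i < j)%N) (qint q (j - i))^-1
    = (\prod_(i < k) qfact q i)^-1.
  rewrite -prod_qint_pairs -prodfV; apply: eq_bigr => i _; exact: prodfV.
have A0 : \prod_(i < k) qfact q i != 0.
  by apply/prodf_neq0 => i _; apply: qfact_neq0.
have B0 : \prod_(i < n) (qfact q (a i) * qfact q (k + n.-1 - a i)) != 0.
  by apply/prodf_neq0 => i _; rewrite mulf_neq0 ?qfact_neq0.
apply: (mulIf A0); apply: (mulIf B0).
rewrite mulfVK //.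
have -> : \prod_(i < n) (qfact q (a i) * qfact q (k + n.-1 - a i)) =
     \prod_(i < n) (qfact q (a i) * qfact q ((k + n).-1 - a i)).
  by apply: eq_bigr => i _; congr (_ * qfact _ _); have := ltn_ord i; lia.
rewrite H.
set B := \prod_(i < n) (_ * _) in H *; set D := \prod_(i < n) _ in H *.
have B0' : B != 0 by apply/prodf_neq0 => i _; rewrite mulf_neq0 ?qfact_neq0.
by rewrite [RHS]mulrAC mulfVK //; ring.
Qed.

End QNumbers.

(** * The q-Pascal recursion and lattice words *)

(** Multilinearity in the columns: S collects the columns in which the first summand is chosen. *)
Lemma det_addcols (K : comPzRingType) (n : nat) (A B : 'I_n -> 'I_n -> K) :
  \det (\matrix_(i, j) (A i j + B i j))
    = \sum_(S : {set 'I_n}) \det (\matrix_(i, j) (if j \in S then A i j else B i j)).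
Proof.
under [RHS]eq_bigr do rewrite -det_tr.
rewrite -det_tr /determinant exchange_big; apply: eq_bigr => s _ /=.
under eq_bigr do rewrite !mxE.
rewrite bigA_distr mulr_sumr; apply: eq_bigr => S _; congr (_ * _).
by apply: eq_bigr => i _; rewrite !mxE.
Qed.

Lemma strict_decr_rev n (a : 'I_n -> nat) :
  (forall i j : 'I_n, (i < j)%N -> (a j < a i)%N) -> forall j, (rev_ord j <= a j)%N.
Proof.
move=> adec j; move e: (rev_ord j : nat) => m; elim: m j e => [//|m IH] j /= e.
have jn : (j.+1 < n)%N by lia.
have /IH : rev_ord (Ordinal jn) = m :> nat by rewrite /=; lia.
by move/leq_ltn_trans; apply; apply: adec => /=.
Qed.

(** Decreasing some entries of a strictly decreasing sequence by one can create equal entries. In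
    that case the determinant vanishes and no lattice word exists, so only strict sequences have to
    be recursed on. *)
Lemma strict_decr_or_eq n (a : 'I_n -> nat) :
  (forall i j : 'I_n, (i < j)%N -> (a j <= a i)%N) ->
  (forall i j : 'I_n, (i < j)%N -> (a j < a i)%N) \/
  (exists i j : 'I_n, (i < j)%N /\ a i = a j).
Proof.
move=> adec.
case: (boolP [exists i : 'I_n, exists j : 'I_n, (i < j)%N && (a i == a j)]).
  by case/existsP => i /existsP[j /andP[ij /eqP e]]; right; exists i, j.
rewrite negb_exists => /forallP H; left => i j ij.
have := H i; rewrite negb_exists => /forallP/(_ j); rewrite ij /= => ne.
by rewrite ltn_neqAle eq_sym ne adec.
Qed.

Lemma decr_sub_set n (a : 'I_n -> nat) (S : {set 'I_n}) :
  (forall i j : 'I_n, (i < j)%N -> (a j < a i)%N) ->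
  forall i j : 'I_n, (i < j)%N -> (a j - (j \in S) <= a i - (i \in S))%N.
Proof. by move=> adec i j /adec; case: (i \in S) => /=; lia. Qed.

Section QDet.
Variables (K : fieldType) (q : K).
Hypothesis qint_neq0 : forall m, qint q m.+1 != 0.
Hypothesis q_neq0 : q != 0.

(** Every column is expanded by the q-Pascal rule, and S is the set of columns whose lower index
    drops. A column with lower index 0 consists of ones and has no dropping term, hence the
    condition on S. *)
Lemma qdetS n k (a : 'I_n -> nat) :
  qdet q k.+1 a = \sum_(S : {set 'I_n} | [forall j in S, 0 < a j]%N)
    (\prod_(j in ~: S) q ^+ a j) * qdet q k (fun j => a j - (j \in S))%N.
Proof.
rewrite [LHS](_ : _ = \det (\matrix_(i, j)
   ((0 < a j)%N%:R * qbinom q (k + rev_ord i) (a j).-1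
      + q ^+ a j * qbinom q (k + rev_ord i) (a j)))); last first.
  congr (\det _); apply/matrixP => i j; rewrite !mxE addSn.
  case: (a j) => [|b]; first by rewrite !qbinomn0 // mul0r expr0 mul1r add0r.
  by rewrite mul1r qbinomS // addrC.
rewrite det_addcols [RHS]big_mkcond /=; apply: eq_bigr => S _.
pose c j := if j \in S then (0 < a j)%N%:R else q ^+ a j.
rewrite [LHS](_ : _ = \det (\matrix_(i, j) (1 * c j *
   (\matrix_(i, j) qbinom q (k + rev_ord i) (a j - (j \in S))) i j))); last first.
  congr (\det _); apply/matrixP => i j; rewrite !mxE mul1r /c.
  by case: ifP => _; rewrite ?subn1 ?subn0.
rewrite det_scale big1 // mul1r; case: ifP => [/forall_inP aS|/forall_inPn[j jS aj]].
  congr (_ * _); rewrite [RHS]big_mkcond; apply: eq_bigr => j _.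
  by rewrite /c inE; case: (boolP (j \in S)) => //= /aS ->.
by rewrite (bigD1 j) //= /c jS; case: (a j) aj => [|//]; rewrite !mul0r.
Qed.

Lemma qdet_eq0 n k (a : 'I_n -> nat) i j : i != j -> a i = a j -> qdet q k a = 0.
Proof.
move=> ij e; rewrite /qdet -det_tr.
by apply: (determinant_alternate ij) => l; rewrite !mxE e.
Qed.

(** Strict decrease forces a_j >= n - 1 - j. The matrix is therefore triangular, with diagonal
    entries 1 where equality holds and 0 elsewhere. *)
Lemma qdet0 n (a : 'I_n -> nat) :
  (forall i j : 'I_n, (i < j)%N -> (a j < a i)%N) ->
  qdet q 0 a = [forall j, a j == rev_ord j]%:R.
Proof.
move=> adec; rewrite /qdet -det_tr det_trig; last first.
  apply/is_trig_mxP => i j ij; rewrite !mxE add0n qbinom_small //.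
  by apply: leq_trans (strict_decr_rev adec i) => /=; have := ltn_ord j; lia.
case: forallP => [H|/forallP/forallPn[j aj]].
  by rewrite big1 // => i _; rewrite !mxE (eqP (H i)) add0n qbinomnn.
rewrite (bigD1 j) //= !mxE add0n qbinom_small ?mul0r //.
by rewrite ltn_neqAle eq_sym aj strict_decr_rev.
Qed.

(** Induction along [qdetS], whose coefficients are powers of q. It yields nonnegativity when [P]
    singles out the polynomials with nonnegative coefficients. *)
Lemma qdet_closed n k (P : K -> Prop) (a : 'I_n -> nat) :
  P 0 -> P 1 -> (forall x y, P x -> P y -> P (x + y)) ->
  (forall x, P x -> P (q * x)) ->
  (forall i j : 'I_n, (i < j)%N -> (a j <= a i)%N) -> P (qdet q k a).
Proof.
move=> P0 P1 PD Pq; elim: k a => [|k IH] a /strict_decr_or_eq[adec|[i [j [ij e]]]].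
- by rewrite qdet0 //; case: forallP.
- by rewrite (qdet_eq0 _ _ e) // neq_ltn ij.
- rewrite qdetS; apply: (big_ind P) => // S _.
  have PX m x : P x -> P (q ^+ m * x).
    by move=> Px; elim: m => [|m ?]; rewrite ?mul1r // exprS -mulrA; apply: Pq.
  rewrite prodrXr; apply: PX; apply: IH; exact: decr_sub_set.
- by rewrite (qdet_eq0 _ _ e) // neq_ltn ij.
Qed.

End QDet.

Section LatticeWords.
Variables (n : nat).

Definition prefix_weight k (f : 'I_k -> {set 'I_n}) (p : nat) (i : 'I_n) : nat :=
  \sum_(r < k | (r < p)%N) (i \in f r).

(* Sequences of row sets whose prefix weights are all dominant; these are the
   semistandard tableaux of the conjugate shape, f p being the set of the
   columns which contain p. *)
Definition lattice_word k (f : 'I_k -> {set 'I_n}) : bool :=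
  [forall p : 'I_k.+1, forall i : 'I_n, forall j : 'I_n,
    (i < j)%N ==> (prefix_weight f p j <= prefix_weight f p i)%N].

(** The staircase [rev_ord i] turns the total weight into beta-numbers, the form in which [qdet]
    takes its argument. *)
Definition lattice_words k (a : 'I_n -> nat) : {set {ffun 'I_k -> {set 'I_n}}} :=
  [set f : {ffun 'I_k -> {set 'I_n}} | lattice_word f
     && [forall i, prefix_weight f k i + rev_ord i == a i]%N].

Lemma lattice_wordP k (f : 'I_k -> {set 'I_n}) :
  reflect (forall p, (p <= k)%N -> forall i j : 'I_n, (i < j)%N ->
             (prefix_weight f p j <= prefix_weight f p i)%N) (lattice_word f).
Proof.
apply: (iffP forallP) => [H p pk i j|H p].
  have /forallP/(_ i)/forallP/(_ j)/implyP := H (Ordinal (pk : (p < k.+1)%N)).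
  exact.
by apply/'forall_forallP => i j; apply/implyP; apply: H; rewrite -ltnS.
Qed.

Definition ffun_rcons (X : finType) k (g : {ffun 'I_k -> X}) (x : X) :
    {ffun 'I_k.+1 -> X} :=
  [ffun r => if unlift ord_max r is Some r' then g r' else x].

Lemma sum_ffun_rcons (X : finType) k (F : {ffun 'I_k.+1 -> X} -> nat) :
  (\sum_f F f = \sum_x \sum_g F (ffun_rcons g x))%N.
Proof.
rewrite pair_big /=.
pose h (u : X * {ffun 'I_k -> X}) := ffun_rcons u.2 u.1.
pose h' (f : {ffun 'I_k.+1 -> X}) := (f ord_max, [ffun r => f (lift ord_max r)]).
rewrite (reindex h) //; exists h' => [[x g] _|f _].
  by rewrite /h /h' ffunE unlift_none; congr pair; apply/ffunP => r; rewrite !ffunE liftK.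
apply/ffunP => r; rewrite ffunE; case: unliftP => [r'|] -> //=.
by rewrite ffunE.
Qed.

Lemma prefix_weight_rcons k (g : {ffun 'I_k -> {set 'I_n}}) S p i :
  prefix_weight (ffun_rcons g S) p i = (prefix_weight g p i + (k < p) * (i \in S))%N.
Proof.
rewrite /prefix_weight big_mkcond big_ord_recr [in RHS]big_mkcond /=; congr (_ + _)%N.
  apply: eq_bigr => r _; rewrite ffunE.
  rewrite (_ : widen_ord _ r = lift ord_max r) ?liftK //.
  by apply: val_inj; rewrite /= /bump leqNgt ltn_ord.
by rewrite ffunE unlift_none; case: ifP => _; rewrite ?mul1n.
Qed.

Lemma strict_decr_gap (a : 'I_n -> nat) :
  (forall i j : 'I_n, (i < j)%N -> (a j < a i)%N) ->
  forall i j : 'I_n, (i < j)%N -> (a j + (j - i) <= a i)%N.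
Proof.
move=> adec i j; move e: (j : nat) => m; elim: m j e => [//|m IH] j e im.
have mn : (m < n)%N by have := ltn_ord j; lia.
have : (a j < a (Ordinal mn))%N by apply: adec; rewrite /= e.
have [/(IH (Ordinal mn) erefl)|mi] := ltnP i m; first by lia.
have -> : Ordinal mn = i by apply: val_inj => /=; lia.
by lia.
Qed.

Lemma prefix_weight_geq k (f : 'I_k -> {set 'I_n}) p i :
  (k <= p)%N -> prefix_weight f p i = prefix_weight f k i.
Proof.
move=> kp; apply: eq_bigl => r; have := ltn_ord r; lia.
Qed.

(** A last letter adds one dominance condition, that of the full word. It holds automatically
    because its weight plus the staircase is the strictly decreasing [a]. *)
Lemma lattice_words_rcons k (a : 'I_n -> nat) g S :
  (forall i j : 'I_n, (i < j)%N -> (a j < a i)%N) ->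
  (ffun_rcons g S \in lattice_words k.+1 a) = [forall j in S, 0 < a j]%N
    && (g \in lattice_words k (fun j => a j - (j \in S))%N).
Proof.
move=> adec; rewrite !inE.
apply/andP/and3P => [[/lattice_wordP L /forallP/= W]|[/forall_inP aS /lattice_wordP L]].
  have {}W i : (prefix_weight g k i + (i \in S) + rev_ord i = a i)%N.
    have := eqP (W i); rewrite prefix_weight_rcons ltnSn mul1n.
    by rewrite prefix_weight_geq.
  split.
  - by apply/forall_inP => j jS; rewrite -W jS addn1 addSn.
  - apply/lattice_wordP => p pk i j ij.
    have := L p (leqW pk) i j ij; rewrite !prefix_weight_rcons.
    by rewrite ltnNge pk !mul0n !addn0.
  - by apply/forallP => i; have /= := W i; case: (i \in S) => /=; lia.
move=> /forallP W.
have {}W i : (prefix_weight g k i + (i \in S) + rev_ord i = a i)%N.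
  have /= := eqP (W i); have := aS i; case: (i \in S) => /=; last by lia.
  by move=> /(_ isT); lia.
split; last first.
  apply/forallP => i; apply/eqP.
  by rewrite prefix_weight_rcons ltnSn mul1n prefix_weight_geq.
apply/lattice_wordP => p pk i j ij; rewrite !prefix_weight_rcons.
have [pk'|kp] := leqP p k; first by rewrite !mul0n !addn0 L.
rewrite !mul1n ![prefix_weight _ p _]prefix_weight_geq ?(ltnW kp) //.
by have /= := strict_decr_gap adec ij; have /= := W i; have /= := W j; have := ltn_ord j; lia.
Qed.

Lemma card_lattice_wordsS k (a : 'I_n -> nat) :
  (forall i j : 'I_n, (i < j)%N -> (a j < a i)%N) ->
  #|lattice_words k.+1 a| = (\sum_(S : {set 'I_n} | [forall j in S, 0 < a j])
    #|lattice_words k (fun j => a j - (j \in S))|)%N.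
Proof.
move=> adec; rewrite -sum1_card big_mkcond sum_ffun_rcons [RHS]big_mkcond.
apply: eq_bigr => S _; under eq_bigr do rewrite lattice_words_rcons //.
case: ifP => _ /=; last by rewrite big1.
by rewrite -big_mkcond sum1_card.
Qed.

Lemma card_lattice_words0 (a : 'I_n -> nat) :
  #|lattice_words 0 a| = [forall j, a j == rev_ord j].
Proof.
have w0 (f : 'I_0 -> {set 'I_n}) p i : prefix_weight f p i = 0%N.
  by rewrite /prefix_weight big1 // => -[].
have L (f : 'I_0 -> {set 'I_n}) : lattice_word f.
  by apply/lattice_wordP => p _ i j _; rewrite !w0.
rewrite [LHS](_ : _ = #|[set f : {ffun 'I_0 -> {set 'I_n}} | [forall j, a j == rev_ord j]]|).
  case: forallP => _; last by rewrite (_ : [set _ | _] = set0) ?cards0 //; apply/setP=> ?; rewrite !inE.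
  by rewrite cardsT card_ffun card_ord expn0.
apply: eq_card => f; rewrite !inE L /=; apply: eq_forallb => i.
by rewrite w0 add0n eq_sym.
Qed.

Lemma lattice_words_strict k (a : 'I_n -> nat) f (i j : 'I_n) :
  f \in lattice_words k a -> (i < j)%N -> (a j < a i)%N.
Proof.
rewrite inE => /andP[/lattice_wordP/(_ k (leqnn k) i j) L /forallP W] ij.
rewrite -(eqP (W i)) -(eqP (W j)) /=; have := L ij; have := ltn_ord j; lia.
Qed.

(** At q = 1 the q-Pascal recursion loses its coefficients and becomes the recursion on the last
    letter of a lattice word. *)
Lemma qdet1_lattice (K : fieldType) k (a : 'I_n -> nat) :
  (forall m, qint (1 : K) m.+1 != 0) ->
  (forall i j : 'I_n, (i < j)%N -> (a j <= a i)%N) ->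
  qdet (1 : K) k a = #|lattice_words k a|%:R.
Proof.
move=> q0; elim: k a => [|k IH] a /strict_decr_or_eq[adec|[i [j [ij e]]]].
- by rewrite (qdet0 q0 (oner_neq0 _) adec) card_lattice_words0.
- have ne : i != j by rewrite neq_ltn ij.
  rewrite (qdet_eq0 _ _ ne e) (_ : lattice_words _ _ = set0) ?cards0 //.
  by apply/setP => f; rewrite in_set0; apply/negP => /lattice_words_strict/(_ ij); rewrite e ltnn.
- rewrite (qdetS q0 (oner_neq0 _)) card_lattice_wordsS // natr_sum.
  apply: eq_bigr => S _; rewrite prodrXr expr1n mul1r.
  by rewrite IH //; apply: decr_sub_set.
- have ne : i != j by rewrite neq_ltn ij.
  rewrite (qdet_eq0 _ _ ne e) (_ : lattice_words _ _ = set0) ?cards0 //.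
  by apply/setP => f; rewrite in_set0; apply/negP => /lattice_words_strict/(_ ij); rewrite e ltnn.
Qed.

End LatticeWords.

(** * Partitions in a rectangle, their conjugates and the q-dimension *)

Section Partitions.
Variables (n k : nat) (la : seq nat).
Hypothesis la_rect : in_rect n k la.

Lemma part_le i : (part la i <= k)%N.
Proof.
case: la_rect => _ _ /allP H; rewrite /part.
by case: (ltnP i.-1 (size la)) => [/(mem_nth 0%N)/H //|/(nth_default 0%N) ->].
Qed.

Lemma part_decr i j : (i <= j)%N -> (part la j.+1 <= part la i.+1)%N.
Proof.
case: la_rect => _ srt _ ij; rewrite /part /=.
case: (ltnP j (size la)) => [js|/(nth_default 0%N) -> //].
have geq_tr : transitive geq by move=> x y z /= yx xz; apply: leq_trans xz yx.
by apply: (sorted_leq_nth geq_tr leqnn 0%N srt) => //; apply: leq_ltn_trans js.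
Qed.

Lemma beta_set_le (j : 'I_n) : (beta_set la j <= k + n.-1)%N.
Proof. by rewrite /beta_set /=; have := part_le j.+1; have := ltn_ord j; lia. Qed.

Lemma beta_set_decr (i j : 'I_n) : (i < j)%N -> (beta_set la j < beta_set la i)%N.
Proof.
move=> ij; have := part_decr (ltnW ij); have := ltn_ord j.
by rewrite /beta_set /=; lia.
Qed.

Lemma part_complement (i : 'I_n) :
  part (complement n k la) i.+1 = (k - part la (n - i))%N.
Proof.
by rewrite /part /= (nth_map 0%N) ?size_iota // nth_iota // add1n subSS.
Qed.

Lemma complement_rect : in_rect n k (complement n k la).
Proof.
split; first by rewrite size_map size_iota.
  rewrite /complement sorted_map.
  apply: (sub_in_sorted (P := [pred x | 0 < x <= n]%N) (e := ltn)).
  - move=> x y; rewrite !inE /= => /andP[x0 xn] /andP[y0 yn] xy.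
    apply: leq_sub2l; have := @part_decr (n - y) (n - x).
    by rewrite !subSn //; apply; lia.
  - by apply/allP => x; rewrite mem_iota inE; lia.
  - exact: iota_ltn_sorted.
by apply/allP => x /mapP[i _ ->]; rewrite leq_subr.
Qed.

Lemma beta_set_complement (i : 'I_n) :
  beta_set (complement n k la) i = (k + n.-1 - beta_set la (rev_ord i))%N.
Proof.
rewrite /beta_set part_complement /= -subSn // subSS subKn ?(ltnW (ltn_ord i)) //.
have := part_le (n - i); have := ltn_ord i; lia.
Qed.

Lemma part_norm_complement :
  part_norm (complement n k la) = (\sum_(i < n) (n - i.+1) * (k - part la i.+1))%N.
Proof.
have [sz _ _] := complement_rect.
rewrite /part_norm sz big_add1 big_mkord (reindex_inj rev_ord_inj) /=.
apply: eq_bigr => i _.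
by rewrite (part_complement (rev_ord i)) /= subKn.
Qed.

Lemma part_conj (j : 'I_k) :
  part (conj_part k la) j.+1 = count (fun x => j < x)%N la.
Proof. by rewrite /part /= (nth_map 0%N) ?size_iota // nth_iota. Qed.

Lemma count_sorted_geq (s : seq nat) (i c : nat) : sorted geq s ->
  (i < count (fun x => c < x)%N s)%N = (c < nth 0%N s i)%N.
Proof.
elim: s i => [|x s IH] i; first by rewrite nth_nil.
rewrite /= path_sortedE; last by move=> ? ? ? /= yx xz; apply: leq_trans xz yx.
case/andP => /allP xs /IH {}IH; case: i => [|i] /=; last first.
  rewrite -IH; case: (ltnP c x) => [|xc]; rewrite ?add1n ?ltnS //; rewrite add0n.
  rewrite (eq_in_count (a2 := pred0)) ?count_pred0 //.
  by move=> y /xs yx; apply/negbTE; rewrite -leqNgt (leq_trans yx).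
case: (ltnP c x) => // xc; rewrite add0n (eq_in_count (a2 := pred0)) ?count_pred0 //.
by move=> y /xs yx; apply/negbTE; rewrite -leqNgt (leq_trans yx).
Qed.

Lemma part_conjP (i : 'I_n) (j : 'I_k) :
  (i < part (conj_part k la) j.+1)%N = (j < part la i.+1)%N.
Proof. by rewrite part_conj count_sorted_geq //; case: la_rect. Qed.

Lemma part_conj_le (j : 'I_k) : (part (conj_part k la) j.+1 <= n)%N.
Proof. by rewrite part_conj (leq_trans (count_size _ _)) //; case: la_rect => ->. Qed.

Lemma part_conj_decr (i j : 'I_k) : (i <= j)%N ->
  (part (conj_part k la) j.+1 <= part (conj_part k la) i.+1)%N.
Proof.
by move=> ij; rewrite !part_conj; apply: sub_count => x /=; apply: leq_ltn_trans.
Qed.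

Section QDim.
Variables (K : fieldType) (q : K).
Hypothesis qint_neq0 : forall m, qint q m.+1 != 0.
Hypothesis q_neq0 : q != 0.

Lemma prod_pairs (m : nat) (F : nat -> nat -> K) :
  \prod_(1 <= i < m.+1) \prod_(i.+1 <= j < m.+1) F i j
    = \prod_(i < m) \prod_(j < m | (i < j)%N) F i.+1 j.+1.
Proof.
rewrite big_add1 big_mkord; apply: eq_bigr => i _.
by rewrite big_add1 /= big_geq_mkord.
Qed.

Lemma MA_qhook :
  MA q n k la = q ^+ part_norm (complement n k la) * qhook q k (@beta_set n la).
Proof.
rewrite MA_qdet; have qX0 m : q ^+ m != 0 by apply: expf_neq0.
set Q := \prod_(i < n) \prod_(d < i) q ^+ d.
have Q0 : Q != 0 by apply/prodf_neq0 => i _; apply/prodf_neq0 => d _.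
apply: (mulIf Q0); rewrite qdet_prod //; first last.
- by move=> i j /beta_set_decr/ltnW.
- exact: beta_set_le.
rewrite -/(qhook _ _ _) mulrAC; congr (_ * _).
rewrite part_norm_complement /Q; under [X in _ = _ * X]eq_bigr do rewrite prodrXr.
rewrite !prodrXr -exprD; congr (_ ^+ _).
(* Each d is counted once for every row i > d, hence n - d - 1 times. The total cancels the
   contribution of the summand i in N - a_i = (k - la_(i+1)) + i. *)
have -> : (\sum_(i < n) \sum_(d < i) d = \sum_(i < n) i * (n - i.+1))%N.
  transitivity (\sum_(i < n) \sum_(d < n | d < i) d)%N.
    by apply: eq_bigr => i _; rewrite (big_ord_widen n (fun d => d)) // ltnW.
  rewrite (exchange_big_dep xpredT) //=; apply: eq_bigr => d _.
  rewrite sum_nat_const mulnC; congr (_ * _)%N; rewrite -sum1_card.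
  rewrite (reindex_inj rev_ord_inj) /=.
  rewrite (eq_bigl (fun j : 'I_n => (j < n - d.+1)%N)); last first.
    by move=> j /=; rewrite unfold_in /=; have := ltn_ord j; lia.
  by rewrite -(big_ord_widen n (fun=> 1%N)) ?leq_subr // sum1_card card_ord.
rewrite -big_split /=; apply: eq_bigr => i _.
have -> : (k + n.-1 - beta_set la i = k - part la i.+1 + i)%N.
  by rewrite /beta_set /=; have := part_le i.+1; have := ltn_ord i; lia.
ring.
Qed.

Lemma qhook_complement_part :
  qhook q k (@beta_set n (complement n k la)) = qhook q k (@beta_set n la).
Proof.
by rewrite (eq_qhook _ _ beta_set_complement) qhook_rev //; apply: beta_set_le.
Qed.

Lemma qdim_conj_part : q != 1 ->
  qdim q k (conj_part k la) = qhook q k (@beta_set n la).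
Proof.
move=> q1; rewrite /qdim prod_pairs.
(* These are the reversed beta-numbers of the conjugate partition; they fill the gaps that the a_i
   leave in [0, n + k - 1]. *)
pose b (j : 'I_k) := (n + j - part (conj_part k la) j.+1)%N.
have bmon (i j : 'I_k) : (i < j)%N -> (b i < b j)%N.
  move=> ij; have := part_conj_le i; have := part_conj_decr (ltnW ij).
  by rewrite /b; lia.
rewrite -(qhook_complement qint_neq0 q_neq0 (b := b)) //.
- apply: eq_bigr => i _; apply: eq_bigr => j ij.
  have E m : 1 - q ^+ m = (1 - q) * qint q m.
    by rewrite -opprB subrX1 -mulNr opprB.
  have q1' : 1 - q != 0 by rewrite subr_eq0 eq_sym.
  rewrite !E subSS -mulf_div divff // mul1r; congr (qint _ _ / _).
  have := part_conj_le i; have := part_conj_decr (ltnW ij); rewrite /b; lia.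
- by move=> i; have := beta_set_le i; have := ltn_ord i; lia.
- by move=> j; rewrite /b; have := ltn_ord j; lia.
- exact: beta_set_decr.
(* Equality would mean la_(i+1) - j = i + 1 - la'_(j+1). By [part_conjP] one side is positive
   exactly when the other is not. *)
- move=> i j; apply/eqP; have := part_conjP i j; have := part_conj_le j.
  rewrite /b /beta_set /=; have := ltn_ord i; have := ltn_ord j; lia.
Qed.

End QDim.
End Partitions.

(** * Unitary representations of gl_n *)

(** A subspace of maximal dimension inside [P] is all of [P], as any further vector would enlarge
    it. This gives subspaces cut out by predicates that are not decidable. *)
Lemma vspace_of_closed (K : fieldType) (V : vectType K) (P : V -> Prop) :
  P 0 -> (forall a x y, P x -> P y -> P (a *: x + y)) ->
  exists U : {vspace V}, forall x, x \in U <-> P x.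
Proof.
move=> P0 PL.
pose Q d := `[< exists2 U : {vspace V}, (forall x, x \in U -> P x) & \dim U = d >].
have exQ : exists d, Q d.
  exists 0%N; apply/asboolP; exists 0%VS; last by rewrite dimv0.
  by move=> x; rewrite memv0 => /eqP ->.
have ubQ d : Q d -> (d <= dim V)%N.
  by case/asboolP => U _ <-; rewrite -dimvf dimvS ?subvf.
case: (ex_maxnP exQ ubQ) => d /asboolP[U UP dU] dmax; exists U => x.
split; first exact: UP.
move=> Px; apply: contraT => xU.
have : Q (\dim (U + <[x]>)%VS).
  apply/asboolP; exists (U + <[x]>)%VS => // _ /memv_addP[u Uu [_ /vlineP[a ->] ->]].
  by rewrite addrC; apply: PL => //; apply: UP.
move/dmax; rewrite -dU => le.
have /eqP e : U == (U + <[x]>)%VS by rewrite eqEdim addvSl.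
by case/negP: xU; rewrite e (subvP (addvSr _ _)) // memv_line.
Qed.

Section HermitianForm.
Variables (F : numClosedFieldType) (I : finType).
Local Notation space := {ffun I -> F^o}.

Definition dot (x y : space) : F := \sum_i (x i : F) * (y i : F)^*.

Lemma dot_linear y : linear (dot^~ y : space -> F^o).
Proof.
move=> a x z; rewrite /dot scaler_sumr -big_split /=; apply: eq_bigr => i _.
by rewrite !ffunE mulrDl /GRing.scale /= mulrA.
Qed.

Lemma dotDl x z y : dot (x + z) y = dot x y + dot z y.
Proof. by have := dot_linear y 1 x z; rewrite !scale1r. Qed.

Lemma dotZl a x y : dot (a *: x) y = a * dot x y.
Proof.
by rewrite /dot mulr_sumr; apply: eq_bigr => i _; rewrite ffunE mulrA.
Qed.

Lemma dotC x y : dot y x = (dot x y)^*.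
Proof.
rewrite /dot rmorph_sum; apply: eq_bigr => i _.
by rewrite rmorphM /= conjCK mulrC.
Qed.

Lemma dot0l y : dot 0 y = 0.
Proof. by rewrite /dot big1 // => i _; rewrite ffunE mul0r. Qed.

Lemma dotxx_ge0 x : 0 <= dot x x.
Proof. by apply: sumr_ge0 => i _; apply: mul_conjC_ge0. Qed.

Lemma dotxx_eq0 x : dot x x = 0 -> x = 0.
Proof.
move=> e; apply/ffunP => i; rewrite ffunE.
move/psumr_eq0P: e => /(_ (fun i _ => mul_conjC_ge0 _) i isT)/eqP.
by rewrite mul_conjC_eq0 => /eqP.
Qed.

Definition perp_coords (U : {vspace space}) (x : space) : 'rV[F]_(\dim U) :=
  \row_i dot x (vbasis U)`_i.

Fact perp_coords_linear U : linear (perp_coords U).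
Proof. by move=> a x y; apply/rowP => i; rewrite !mxE dotDl dotZl. Qed.
HB.instance Definition _ U :=
  GRing.isLinear.Build F space 'rV[F]_(\dim U) *:%R (perp_coords U)
    (perp_coords_linear U).

Definition perp (U : {vspace space}) : {vspace space} :=
  lker (linfun (perp_coords U)).

Lemma perpP (U : {vspace space}) x : reflect (forall u, u \in U -> dot x u = 0) (x \in perp U).
Proof.
rewrite memv_ker lfunE /=; apply: (iffP eqP) => [/rowP e u Uu|H].
  rewrite (coord_vbasis Uu) dotC.
  apply/eqP; rewrite conjC_eq0; apply/eqP.
  apply: (big_ind (fun v => dot v x = 0)) => [|v w ev ew|i _]; first exact: dot0l.
    by rewrite dotDl ev ew addr0.
  by rewrite dotZl dotC; have := e i; rewrite !mxE => ->; rewrite conjC0 mulr0.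
by apply/rowP => i; rewrite !mxE H // vbasis_mem // mem_nth ?size_tuple.
Qed.

Lemma capv_perp U : (U :&: perp U)%VS = 0%VS.
Proof.
apply/eqP; rewrite -subv0; apply/subvP => x /memv_capP[Ux /perpP H].
by rewrite memv0; apply/eqP/dotxx_eq0/H.
Qed.

Lemma addv_perp (U1 U : {vspace space}) : (U1 <= U)%VS ->
  (U1 + (U :&: perp U1))%VS = U.
Proof.
move=> sU; apply/eqP; rewrite eqEdim subv_add sU capvSl /=.
rewrite dimv_disjoint_sum; last first.
  by rewrite capvC -capvA [(perp _ :&: _)%VS]capvC capv_perp capv0.
rewrite -(limg_ker_dim (linfun (perp_coords U1)) U) addnC leq_add2r.
by rewrite (leq_trans (dimvS (subvf _))) // dimvf /dim /= mul1n.
Qed.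

End HermitianForm.

Section UnitaryRep.
Variables (F : numClosedFieldType) (n : nat) (W : glRep F n).
Local Notation space := {ffun rep_idx W -> F^o}.
Local Notation E i j := (rep_act (delta_mx i j)).

(** Equivalently, skew-Hermitian matrices act by skew-Hermitian operators. *)
Definition unitary_rep : Prop :=
  forall (i j : 'I_n) (x y : space), dot (E i j x) y = dot x (E j i y).

Definition rep_act_at (x : space) : {linear 'M[F]_n -> space} :=
  HB.pack (fun A => @rep_act F n W A x)
    (GRing.isLinear.Build F 'M[F]_n space *:%R _ (rep_linearl x)).

Lemma rep_act_sum (A : 'M[F]_n) (x : space) :
  rep_act A x = \sum_i \sum_j A i j *: E i j x.
Proof.
rewrite -[LHS]/(rep_act_at x A) {1}(matrix_sum_delta A) linear_sum; apply: eq_bigr => i _.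
by rewrite linear_sum; apply: eq_bigr => j _; rewrite linearZ.
Qed.

Lemma subrepP (U : {vspace space}) :
  subrep U <-> forall i j x, x \in U -> E i j x \in U.
Proof.
split=> [H i j x|H A x xU]; first exact: H.
by rewrite rep_act_sum; apply: rpred_sum => i _; apply: rpred_sum => j _;
   apply/rpredZ/H.
Qed.

Lemma act_comm (i j k l : 'I_n) (x : space) :
  E i j (E k l x) = E k l (E i j x) + (j == k)%:R *: E i l x - (l == i)%:R *: E k j x.
Proof.
have D b (a c : 'I_n) : rep_act (delta_mx a c *+ b) x = b%:R *: E a c x :> space.
  by rewrite scaler_nat -[LHS]/(rep_act_at x _) raddfMn.
have B (A B : 'M[F]_n) : rep_act (A - B) x = rep_act A x - rep_act B x :> space.
  by rewrite -[LHS]/(rep_act_at x _) raddfB.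
have := rep_bracket (delta_mx i j) (delta_mx k l) x.
rewrite !mul_delta_mx_cond B !D => e.
by rewrite -addrA e addrC subrK.
Qed.

Hypothesis uW : unitary_rep.

Lemma subrep_perp (U : {vspace space}) : subrep U -> subrep (perp U).
Proof.
move=> /subrepP sU; apply/subrepP => i j x /perpP H; apply/perpP => u Uu.
by rewrite uW H // sU.
Qed.

Lemma subrep_cap (U V : {vspace space}) :
  subrep U -> subrep V -> subrep (U :&: V)%VS.
Proof.
by move=> sU sV A x; rewrite !memv_cap => /andP[/sU -> /sV ->].
Qed.

Lemma irreducible_in (U : {vspace space}) : subrep U -> U != 0%VS ->
  exists2 U', (U' <= U)%VS & irreducible_subrep U'.
Proof.
move=> sU U0.
pose Q d := `[< exists U' : {vspace space},
  [/\ subrep U', U' != 0%VS, (U' <= U)%VS & \dim U' = d] >].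
have exQ : exists d, Q d by exists (\dim U); apply/asboolP; exists U.
case: (ex_minnP exQ) => d /asboolP[U' [sU' U'0 U'U dU']] dmin.
exists U' => //; split=> // V sV VU'; have [->|V0] := eqVneq V 0%VS; first by left.
right; apply/eqP; rewrite eqEdim VU' dU' dmin //.
by apply/asboolP; exists V; split=> //; apply: subv_trans U'U.
Qed.

(** An irreducible subrepresentation is split off, and the induction continues in its orthogonal
    complement, which is again invariant. *)
Lemma complete_reducibility (U : {vspace space}) : subrep U ->
  exists r (Us : 'I_r -> {vspace space}), [/\ forall i, irreducible_subrep (Us i),
    (\sum_(i < r) Us i)%VS = U & directv (\sum_(i < r) Us i)].
Proof.
have [d] := ubnP (\dim U); elim: d U => // d IH U dU sU.
have [->|U0] := eqVneq U 0%VS.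
  exists 0%N, (fun=> 0%VS); split; [by case|by rewrite big_ord0|].
  by apply/directv_sum_independent => us _ _ [].
have [U1 U1U irr1] := irreducible_in sU U0.
have [sU1 U10 _] := irr1.
pose U2 := (U :&: perp U1)%VS.
have sU2 : subrep U2 by apply/subrep_cap/subrep_perp.
have U12 : (U1 :&: U2 = 0)%VS.
  by rewrite /U2 capvC -capvA [(perp _ :&: _)%VS]capvC capv_perp capv0.
have dU2 : (\dim U2 < d)%N.
  have := dimv_disjoint_sum U12; rewrite addv_perp // => e.
  have : (0 < \dim U1)%N by rewrite lt0n dimv_eq0.
  by move: dU; rewrite e ltnS; lia.
have [r [Us [irr sumU dir]]] := IH _ dU2 sU2.
exists r.+1, (fun i => if unlift ord0 i is Some j then Us j else U1).
have sumE : (\sum_(i < r.+1) (if unlift ord0 i is Some j then Us j else U1))%VS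
    = (U1 + U2)%VS.
  rewrite big_ord_recl unlift_none; congr (_ + _)%VS.
  by rewrite -sumU; apply: eq_bigr => i _; rewrite liftK.
split.
- by move=> i; case: unliftP => [j|] _.
- by rewrite sumE addv_perp.
apply/directvP => /=; rewrite sumE dimv_disjoint_sum // big_ord_recl unlift_none.
rewrite /= -sumU; congr (_ + _)%N.
by rewrite (directvP dir) /=; apply: eq_bigr => i _; rewrite liftK.
Qed.

Definition hw_vector (la : seq nat) (v : space) : Prop :=
  (forall i j : 'I_n, (i < j)%N -> E i j v = 0)
  /\ (forall i : 'I_n, E i i v = (part la i.+1)%:R *: v).

Lemma hw_vector0 la : hw_vector la 0.
Proof. by split=> [i j _|i]; rewrite linear0 ?scaler0. Qed.

Lemma hw_vector_linear la a v w :
  hw_vector la v -> hw_vector la w -> hw_vector la (a *: v + w).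
Proof.
move=> [v1 v2] [w1 w2]; split=> [i j ij|i].
  by rewrite linearP /= v1 // w1 // scaler0 addr0.
by rewrite linearP /= v2 w2 scalerDr !scalerA mulrC.
Qed.

(* The subspace spanned by lowering operators applied to v is a
   subrepresentation; a highest weight vector orthogonal to v is orthogonal to
   all of it. *)
Lemma hw_vector_unique (U : {vspace space}) la (v w : space) :
  irreducible_subrep U -> v \in U -> w \in U -> hw_vector la v -> hw_vector la w ->
  v != 0 -> dot w v = 0 -> w = 0.
Proof.
move=> [sU _ irrU] vU wU [v1 v2] [w1 w2] v0 wv.
(* The span of the lowered vectors is obtained as the intersection [L] of all subspaces that contain
   v and are stable under lowering. *)
pose lowered (Y : {vspace space}) :=
  v \in Y /\ forall i j : 'I_n, (j < i)%N -> forall y, y \in Y -> E i j y \in Y.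
have [L LP] : exists L : {vspace space},
    forall x, x \in L <-> forall Y, lowered Y -> x \in Y.
  apply: vspace_of_closed => [Y _|a x y Hx Hy Y HY]; first exact: mem0v.
  by rewrite memvD // ?memvZ ?Hx ?Hy.
have lowL : lowered L.
  split=> [|i j ij y /LP Hy]; first by apply/LP => Y [].
  by apply/LP => Y HY; case: (HY) => _; apply=> //; apply: Hy.
have subL : subrep L.
  (* The vectors of [L] that no E_ij takes out of [L] form a subspace [L'] that again contains v
     and, by the commutation relations, is stable under lowering. Hence [L'] contains [L]. *)
  have [L' L'P] : exists L' : {vspace space},
      forall x, x \in L' <-> (x \in L /\ forall i j, E i j x \in L).
    apply: vspace_of_closed => [|a x y [Lx Hx] [Ly Hy]].
      by split=> [|i j]; rewrite ?linear0 mem0v.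
    split=> [|i j]; first by rewrite memvD ?memvZ.
    by rewrite linearP /= memvD ?memvZ.
  suff lowL' : lowered L'.
    by apply/subrepP => i j x /LP/(_ L' lowL')/L'P[_]; apply.
  have [vL sL] := lowL.
  split=> [|i j ij y /L'P[yL Hy]]; apply/L'P; split=> // k l.
    case: (ltngtP k l) => [kl|lk|/ord_inj <-]; last by rewrite v2 memvZ.
      by rewrite v1 // mem0v.
    exact: sL.
  by rewrite act_comm memvB ?memvD ?memvZ // sL.
have LU : (L <= U)%VS.
  by apply/subvP => x /LP; apply; split=> // i j _ y; apply: sU.
have LE : L = U.
  have [L0|//] := irrU _ subL LU.
  by case/negP: v0; rewrite -memv0 -L0; case: lowL.
(* The orthogonal complement of w in U is stable under lowering, since the adjoint raising operators
   kill w. It contains v, hence all of [L], hence w itself. *)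
have [Y YP] : exists Y : {vspace space}, forall x, x \in Y <-> (x \in U /\ dot x w = 0).
  apply: vspace_of_closed => [|a x y [Ux Hx] [Uy Hy]]; first by rewrite mem0v dot0l.
  by rewrite memvD ?memvZ // dotDl dotZl Hx Hy mulr0 addr0.
have lowY : lowered Y.
  split=> [|i j ij y /YP[Uy _]]; first by apply/YP; rewrite dotC wv conjC0.
  apply/YP; split; first exact: sU.
  by rewrite uW w1 // dotC dot0l conjC0.
have := wU; rewrite -LE => /LP/(_ Y lowY)/YP[_]; exact: dotxx_eq0.
Qed.

Definition hw_space (la : seq nat) : {vspace space} :=
  projT1 (cid (vspace_of_closed (P := hw_vector la) (hw_vector0 la)
    (@hw_vector_linear la))).

Lemma hw_spaceP la x : x \in hw_space la <-> hw_vector la x.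
Proof. by rewrite /hw_space; case: cid => U /= UP; apply: UP. Qed.

Lemma dim_hw_irreducible (U : {vspace space}) la : irreducible_subrep U ->
  \dim (U :&: hw_space la) = `[< has_highest_weight U la >].
Proof.
move=> irrU; case: asboolP => [[v [vU v0 v1 v2]]|nhw]; last first.
  apply/eqP; rewrite dimv_eq0 -subv0; apply/subvP => v /memv_capP[vU /hw_spaceP[v1 v2]].
  by rewrite memv0; apply: contra_notT nhw => v0; exists v.
have hv : hw_vector la v by [].
suff -> : (U :&: hw_space la)%VS = <[v]>%VS by rewrite dim_vline v0.
apply/eqP; rewrite eqEsubv; apply/andP; split; last first.
  by rewrite -memvE memv_cap vU; apply/hw_spaceP.
apply/subvP => w /memv_capP[wU /hw_spaceP hw].
have dv0 : dot v v != 0 by apply: contra_neq v0; apply: dotxx_eq0.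
(* The scalar that makes [c *: v + w] orthogonal to v. *)
pose c := - (dot w v / dot v v).
have : c *: v + w = 0.
  apply: (hw_vector_unique irrU vU _ hv _ v0).
  - by rewrite memvD ?memvZ.
  - exact: hw_vector_linear.
  - by rewrite dotDl dotZl /c mulNr divfK // addNr.
move/eqP; rewrite addrC addr_eq0 => /eqP ->.
by rewrite memvN memvZ // memv_line.
Qed.

(** The components of a highest weight vector in a decomposition are highest weight vectors too,
    because the summands are invariant and independent. So [hw_space la] is the direct sum of its
    intersections with the summands, each of dimension 1 or 0. *)
Lemma multiplicity_unitary la : is_multiplicity W la (\dim (hw_space la)).
Proof.
split=> [|r U [irr sumU dir]].
  have sf : subrep (fullv : {vspace space}) by move=> A x _; apply: memvf.
  by have [r [U [irr sumU dir]]] := complete_reducibility sf; exists r, U.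
have -> : hw_space la = (\sum_(i < r) (U i :&: hw_space la))%VS.
  apply/eqP; rewrite eqEsubv; apply/andP; split; last first.
    by apply/subv_sumP => i _; apply: capvSr.
  apply/subvP => x /hw_spaceP[x1 x2].
  have /memv_sumP[xs xsU xE] : x \in (\sum_(i < r) U i)%VS by rewrite sumU memvf.
  have indep := directv_sum_independent dir.
  rewrite xE; apply: memv_sumr => i _; rewrite memv_cap xsU //=.
  apply/hw_spaceP; split=> [a b ab|a].
    have /indep H s : true -> rep_act (delta_mx a b) (xs s) \in U s.
      by move=> _; have [sU _ _] := irr s; apply/sU/xsU.
    by apply: H => //; rewrite -linear_sum -xE; apply: x1.
  apply/eqP; rewrite -subr_eq0; apply/eqP.
  have /indep H s : true -> rep_act (delta_mx a a) (xs s)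
      - (part la a.+1)%:R *: xs s \in U s.
    by move=> _; have [sU _ _] := irr s; rewrite memvB ?memvZ ?sU ?xsU.
  by apply: H => //; rewrite sumrB -scaler_sumr -linear_sum -xE; apply/eqP; rewrite subr_eq0; apply/eqP/x2.
have dirH : directv (\sum_(i < r) (U i :&: hw_space la)%VS).
  apply/directv_sum_independent => us usU; apply: (directv_sum_independent dir).
  by move=> i _; have /memv_capP[] := usU i isT.
rewrite (directvP dirH) /= -sum1_card big_mkcond; apply: eq_bigr => i _.
by rewrite dim_hw_irreducible // inE; case: asboolP.
Qed.

End UnitaryRep.

(** * Creation operators on the tensor power *)

Section SlotOperators.
Variables (F : numClosedFieldType) (n k : nat).
Local Notation ext := {ffun {set 'I_n} -> F^o}.
Local Notation word := {ffun 'I_k -> {set 'I_n}}.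
Local Notation space := {ffun word -> F^o}.
Local Notation before S i := #|[set s in S | (s < i)%N]|.

Definition upd (f : word) (p : 'I_k) (S : {set 'I_n}) : word :=
  [ffun r => if r == p then S else f r].

Lemma updE f p S r : upd f p S r = if r == p then S else f r.
Proof. by rewrite ffunE. Qed.

Lemma upd_same f p S : upd f p S p = S.
Proof. by rewrite updE eqxx. Qed.

Lemma upd_id f p : upd f p (f p) = f.
Proof. by apply/ffunP => r; rewrite updE; case: eqP => [->|]. Qed.

Lemma upd_upd f p S S' : upd (upd f p S) p S' = upd f p S'.
Proof. by apply/ffunP => r; rewrite !updE; case: eqP. Qed.

Lemma updC f p r S S' : p != r -> upd (upd f p S) r S' = upd (upd f r S') p S.
Proof.
move=> pr; apply/ffunP => t; rewrite !updE.
by case: (eqVneq t r) => [->|//]; rewrite eq_sym (negPf pr).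
Qed.

Definition slice (x : space) (f : word) (p : 'I_k) : ext :=
  [ffun S => x (upd f p S)].

(** No sign comes from the other slots, so operators in different slots commute while those in one
    slot obey the exterior relations. *)
Definition cre p i (x : space) : space :=
  [ffun f : word => creation i (slice x f p) (f p)].

Definition ann p i (x : space) : space :=
  [ffun f : word => annihilation i (slice x f p) (f p)].

Lemma creE p i x f : cre p i x f =
  if i \in f p then (-1) ^+ before (f p) i * x (upd f p (f p :\ i)) else 0.
Proof. by rewrite !ffunE. Qed.

Lemma annE p i x f : ann p i x f =
  if i \in f p then 0 else (-1) ^+ before (f p) i * x (upd f p (i |: f p)).
Proof. by rewrite !ffunE. Qed.

Lemma slice_cre p i x f : slice (cre p i x) f p = creation i (slice x f p).
Proof.
apply/ffunP => S; rewrite ffunE [LHS]ffunE upd_same; congr (creation i _ S).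
by apply/ffunP => S'; rewrite !ffunE upd_upd.
Qed.

Lemma slice_ann p i x f : slice (ann p i x) f p = annihilation i (slice x f p).
Proof.
apply/ffunP => S; rewrite ffunE [LHS]ffunE upd_same; congr (annihilation i _ S).
by apply/ffunP => S'; rewrite !ffunE upd_upd.
Qed.

Lemma sliceP a x y f p : slice (a *: x + y) f p = a *: slice x f p + slice y f p.
Proof. by apply/ffunP => S; rewrite !ffunE. Qed.

Fact cre_linear p i : linear (cre p i).
Proof.
by move=> a x y; apply/ffunP => f; rewrite [LHS]ffunE sliceP linearP /= !ffunE.
Qed.
HB.instance Definition _ p i :=
  GRing.isLinear.Build F space space *:%R (cre p i) (cre_linear p i).

Fact ann_linear p i : linear (ann p i).
Proof.
by move=> a x y; apply/ffunP => f; rewrite [LHS]ffunE sliceP linearP /= !ffunE.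
Qed.
HB.instance Definition _ p i :=
  GRing.isLinear.Build F space space *:%R (ann p i) (ann_linear p i).

Lemma ann_cre p i j x :
  ann p i (cre p j x) + cre p j (ann p i x) = (i == j)%:R *: x.
Proof.
apply/ffunP => f; rewrite ffunE [ann _ _ _ _]ffunE [cre _ _ _ _]ffunE.
rewrite slice_cre slice_ann -[LHS]/((_ : ext) _ + _).
have /ffunP/(_ (f p)) := annihilation_creation i j (slice x f p).
by rewrite ffunE => ->; rewrite !ffunE upd_id.
Qed.

Lemma creC p r i j x : cre p i (cre r j x) =
  if p == r then - cre r j (cre p i x) else cre r j (cre p i x).
Proof.
apply/ffunP => f; case: eqVneq => [<-|pr].
  by rewrite [LHS]ffunE slice_cre creationC -slice_cre [LHS]ffunE [RHS]ffunE [in RHS]ffunE.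
rewrite !creE !updE (negPf pr) [r == p]eq_sym (negPf pr).
case: ifP => _; case: ifP => _; rewrite ?mulr0 // mulrCA; congr (_ * (_ * x _)).
exact: updC.
Qed.

Lemma ann_creC p r i j x : p != r -> ann p i (cre r j x) = cre r j (ann p i x).
Proof.
move=> pr; apply/ffunP => f.
rewrite annE !creE annE !updE (negPf pr) [r == p]eq_sym (negPf pr).
case: ifP => _; case: ifP => _; rewrite ?mulr0 // mulrCA; congr (_ * (_ * x _)).
exact: updC.
Qed.

Lemma annC p r i j x : p != r -> ann p i (ann r j x) = ann r j (ann p i x).
Proof.
move=> pr; apply/ffunP => f.
rewrite !annE !updE (negPf pr) [r == p]eq_sym (negPf pr).
case: ifP => _; case: ifP => _; rewrite ?mulr0 // mulrCA; congr (_ * (_ * x _)).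
exact: updC.
Qed.

(** Adding i to slot p is a bijection from the words without i there to the words with it, and both
    operators carry the same sign along it. *)
Lemma dot_cre p i x y : dot (cre p i x) y = dot x (ann p i y).
Proof.
rewrite /dot (bigID (fun f : word => i \in f p)) /= [X in _ + X]big1 ?addr0; last first.
  by move=> f /negPf fi; rewrite creE fi mul0r.
rewrite [RHS](bigID (fun f : word => i \in f p)) /= [X in _ = X + _]big1 ?add0r; last first.
  by move=> f fi; rewrite annE fi conjC0 mulr0.
pose g (f : word) := upd f p (i |: f p); pose h (f : word) := upd f p (f p :\ i).
rewrite (reindex_onto g h) /=; last first.
  by move=> f fi; rewrite /g /h upd_same upd_upd setD1K // upd_id.
apply: eq_big => f.
  rewrite /g /h upd_same setU11 /= upd_upd; apply/eqP/idP => [e|fi].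
    by rewrite -e upd_same !inE eqxx.
  by rewrite setU1K // upd_id.
rewrite /g upd_same setU11 /= => /eqP e.
have fi : i \notin f p by rewrite -e /h upd_same !inE eqxx.
rewrite creE annE upd_same setU11 (negPf fi) upd_upd setU1K // upd_id.
by rewrite before_U1id rmorphM /= rmorph_sign -mulrA mulrCA.
Qed.

End SlotOperators.

Section SlotDecomposition.
Variables (F : numClosedFieldType) (n k : nat).
Local Notation ext := {ffun {set 'I_n} -> F^o}.
Local Notation word := {ffun 'I_k -> {set 'I_n}}.
Local Notation space := {ffun word -> F^o}.
Local Notation W := (tens_rep (ext_rep F n) k).
Local Notation E i j := (@rep_act F n W (delta_mx i j)).

Definition eslot p i j (x : space) : space := cre p i (ann p j x).

Lemma ext_act_delta i j (z : ext) :
  ext_act (delta_mx i j) z = creation i (annihilation j z).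
Proof.
rewrite ext_actE /second_quant (bigD1 i) //= [X in _ + X]big1 ?addr0; last first.
  by move=> a /negPf ai; apply: big1 => b _; rewrite mxE ai scale0r.
rewrite (bigD1 j) //= [X in _ + X]big1 ?addr0; last first.
  by move=> b /negPf bj; rewrite mxE bj andbF scale0r.
by rewrite mxE !eqxx scale1r.
Qed.

Lemma slice_tens (y : 'I_k -> ext) g p :
  slice (@tens F n (ext_rep F n) k y : space) g p
    = (\prod_(r | r != p) (y r (g r) : F)) *: y p.
Proof.
apply/ffunP => S; rewrite !ffunE (bigD1 p) //= upd_same mulrC.
by congr (_ * _); apply: eq_bigr => r rp; rewrite updE (negPf rp).
Qed.

Lemma tens_slot_map (T : {linear ext -> ext}) (y : 'I_k -> ext) p g :
  T (slice (@tens F n (ext_rep F n) k y : space) g p) (g p)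
    = @tens F n (ext_rep F n) k (fun q => if q == p then T (y q) else y q) g.
Proof.
rewrite slice_tens linearZ !ffunE [RHS](bigD1 p) //= eqxx /GRing.scale /= mulrC.
by congr (_ * _); apply: eq_bigr => r rp; rewrite (negPf rp).
Qed.

Lemma eslot_slice p i j x f :
  eslot p i j x f = ext_act (delta_mx i j) (slice x f p) (f p).
Proof. by rewrite ext_act_delta -slice_ann [LHS]ffunE. Qed.

Fact eslot_linear p i j : linear (eslot p i j).
Proof. by move=> a x y; rewrite /eslot !linearP. Qed.
HB.instance Definition _ p i j :=
  GRing.isLinear.Build F space space *:%R (eslot p i j) (eslot_linear p i j).

Lemma rep_act_slots i j x : E i j x = \sum_p eslot p i j x.
Proof.
transitivity (\sum_f x f *: \sum_p eslot p i j (bvec F f)); last first.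
  under eq_bigr do rewrite scaler_sumr.
  rewrite exchange_big; apply: eq_bigr => p _ /=.
  rewrite {2}(coordE x) linear_sum; apply: eq_bigr => f _; by rewrite linearZ.
rewrite {1}(coordE x) linear_sum; apply: eq_bigr => f _; rewrite linearZ; congr (_ *: _).
rewrite [bvec F f](bvec_tens (W := ext_rep F n)) /= tens_act_tens.
apply: eq_bigr => p _; apply/ffunP => g.
pose T : {linear ext -> ext} := HB.pack (@ext_act F n (delta_mx i j))
  (GRing.isLinear.Build F ext ext *:%R _ (@ext_act_linear F n (delta_mx i j))).
by rewrite eslot_slice -[ext_act _]/(T : ext -> ext) tens_slot_map.
Qed.

Lemma dot_eslot p i j x y : dot (eslot p i j x) y = dot x (eslot p j i y).
Proof. by rewrite /eslot dot_cre [RHS]dotC dot_cre -dotC. Qed.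

Lemma eslot_diag p i x f : eslot p i i x f = (i \in f p)%:R * (x f : F).
Proof.
rewrite creE; case: (boolP (i \in f p)) => fi; last by rewrite mul0r.
rewrite annE upd_same !inE eqxx /= upd_upd setD1K // upd_id before_D1id.
by rewrite mulrA -expr2 sqrr_sign.
Qed.

Lemma eslotC p r i j a b x : p != r ->
  eslot p i j (eslot r a b x) = eslot r a b (eslot p i j x).
Proof.
move=> pr; have rp : r != p by rewrite eq_sym.
rewrite /eslot (ann_creC _ _ _ pr) creC (negPf pr) (annC _ _ _ pr).
by rewrite (ann_creC _ _ _ rp).
Qed.

Lemma eslot_comm p i j x :
  eslot p i j (eslot p j i x) = eslot p j i (eslot p i j x) + eslot p i i x - eslot p j j x.
Proof.
have S a b y f : slice (eslot p a b y) f p = ext_act (delta_mx a b) (slice y f p).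
  by rewrite /eslot slice_cre slice_ann ext_act_delta.
apply/ffunP => f; rewrite [RHS]ffunE [X in X + _]ffunE [X in _ + X]ffunE !eslot_slice !S.
have := @act_comm F n (ext_rep F n) i j j i (slice x f p).
by rewrite !eqxx !scale1r /= => ->; rewrite [LHS]ffunE [X in X + _ = _]ffunE [X in _ + X = _]ffunE.
Qed.

(** The action of E_ij on the tensor product of the first m factors, the later slots being inert. *)
Definition eprefix (m : nat) i j (x : space) : space :=
  \sum_(p < k | (p < m)%N) eslot p i j x.

Lemma dot_suml (I : finType) (P : pred I) (x : I -> space) y :
  dot (\sum_(i | P i) x i) y = \sum_(i | P i) dot (x i) y.
Proof. by apply: (big_morph (fun z => dot z y)) => [? ?|]; rewrite ?dotDl ?dot0l. Qed.

Lemma dot_sumr (I : finType) (P : pred I) (x : I -> space) y :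
  dot y (\sum_(i | P i) x i) = \sum_(i | P i) dot y (x i).
Proof. by rewrite dotC dot_suml rmorph_sum; apply: eq_bigr => i _; rewrite /= -dotC. Qed.

Lemma dot_eprefix m i j x y : dot (eprefix m i j x) y = dot x (eprefix m j i y).
Proof. by rewrite dot_suml dot_sumr; apply: eq_bigr => p _; apply: dot_eslot. Qed.

(** In the double sum over slots the terms with distinct slots commute, so only the commutators
    within one slot remain. *)
Lemma eprefix_comm m i j x :
  eprefix m i j (eprefix m j i x)
    = eprefix m j i (eprefix m i j x) + eprefix m i i x - eprefix m j j x.
Proof.
rewrite /eprefix [LHS](eq_bigr (fun p : 'I_k => \sum_(r < k | (r < m)%N)
   eslot p i j (eslot r j i x))); last by move=> p _; rewrite linear_sum.
rewrite [X in X + _ - _](eq_bigr (fun p : 'I_k => \sum_(r < k | (r < m)%N)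
   eslot p j i (eslot r i j x))); last by move=> p _; rewrite linear_sum.
rewrite [X in X + _ - _]exchange_big -big_split -sumrB /=; apply: eq_bigr => p pm.
rewrite (bigD1 p) // [in RHS](bigD1 p) //= eslot_comm.
rewrite [X in _ + X = _](eq_bigr (fun r : 'I_k => eslot r j i (eslot p i j x))); last first.
  by move=> r /andP[_ rp]; rewrite eslotC // eq_sym.
by rewrite -!addrA; congr (_ + _); rewrite [RHS]addrC -addrA.
Qed.

Lemma eprefix_diag m i x f : eprefix m i i x f = (prefix_weight f m i)%:R * (x f : F).
Proof.
rewrite sum_ffunE /prefix_weight natr_sum mulr_suml; apply: eq_bigr => p _.
exact: eslot_diag.
Qed.

Lemma rep_act_eprefix i j x : E i j x = eprefix k i j x.
Proof. by rewrite rep_act_slots /eprefix; apply: eq_bigl => p; rewrite ltn_ord. Qed.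

Lemma tens_ext_unitary : unitary_rep W.
Proof. by move=> i j x y; rewrite !rep_act_eprefix dot_eprefix. Qed.

(** Each basis word is a weight vector, so all words in the support share the weight of x. *)
Lemma hw_vector_supp la (x : space) f i : hw_vector (W := W) la x -> x f != 0 ->
  prefix_weight f k i = part la i.+1.
Proof.
move=> [_ /(_ i)]; rewrite rep_act_eprefix => /ffunP/(_ f).
rewrite eprefix_diag ffunE => /mulIf e xf; apply/eqP.
by rewrite -(eqr_nat F); apply/eqP/e.
Qed.

End SlotDecomposition.

(** * Leading words of highest weight vectors *)

Section UpperBound.
Variables (F : numClosedFieldType) (n k : nat).
Local Notation word := {ffun 'I_k -> {set 'I_n}}.
Local Notation space := {ffun word -> F^o}.
Local Notation W := (tens_rep (ext_rep F n) k).

(** The squared norm of E_ji y equals (a - b) times that of y, by adjointness and the commutator of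
    E_ij and E_ji. *)
Lemma hw_weight_dominant m i j (y : space) (a b : nat) : y != 0 ->
  eprefix m i j y = 0 -> eprefix m i i y = a%:R *: y ->
  eprefix m j j y = b%:R *: y -> (b <= a)%N.
Proof.
move=> y0 ij ii jj.
have := dotxx_ge0 (eprefix m j i y); rewrite -dot_eprefix eprefix_comm ij ii jj.
rewrite /eprefix big1 ?add0r => [|p _]; last by rewrite linear0.
rewrite -scaleNr dotDl !dotZl -mulrDl pmulr_lge0; last first.
  by rewrite lt0r dotxx_ge0 andbT; apply: contra_neq y0; apply: dotxx_eq0.
by rewrite subr_ge0 ler_nat.
Qed.

Definition set_sum (S : {set 'I_n}) : nat := (\sum_(s in S) s)%N.

(* The base B exceeds every set_sum, so word_key compares words
   lexicographically, the last slot being the most significant one. *)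
Local Notation B := (n * n).+1.
Definition word_key (g : word) : nat := (\sum_p set_sum (g p) * B ^ p)%N.

Lemma set_sum_lt S : (set_sum S < B)%N.
Proof.
rewrite ltnS /set_sum big_mkcond (@leq_trans (\sum_(s < n) n)%N) //.
  by apply: leq_sum => s _; case: ifP => // _; apply: ltnW.
by rewrite sum_nat_const card_ord.
Qed.

Lemma set_sum_exchange (S : {set 'I_n}) (i j : 'I_n) : (i < j)%N ->
  i \in S -> j \notin S :\ i -> (set_sum S < set_sum (j |: S :\ i))%N.
Proof.
by move=> ij iS jS; rewrite /set_sum (big_setU1 _ jS) (big_setD1 i iS) ltn_add2r.
Qed.

Lemma prefix_key_lt (g : word) m :
  (\sum_(p < k | (p < m)%N) set_sum (g p) * B ^ p < B ^ m)%N.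
Proof.
elim: m => [|m IH]; first by rewrite big1.
have [mk|km] := ltnP m k; last first.
  rewrite (eq_bigl (fun p : 'I_k => p < m)%N); last by move=> p; have := ltn_ord p; lia.
  by apply: leq_trans IH _; rewrite leq_pexp2l.
rewrite (bigD1 (Ordinal mk)) //= (eq_bigl (fun p : 'I_k => p < m)%N); last first.
  by move=> p; rewrite ltnS ltn_neqAle andbC; congr (_ && _).
have := set_sum_lt (g (Ordinal mk)); rewrite ltnS => le.
rewrite expnS mulSn addnC -addSn leq_add // leq_mul //.
Qed.

(** The gain in slot p is at least B^p, which outweighs everything in the slots below m, where g and
    h are unrelated. *)
Lemma word_key_lt (g h : word) m (p : 'I_k) S : (m <= p)%N ->
  (forall r : 'I_k, (m <= r)%N -> h r = g r) -> (set_sum (g p) < set_sum S)%N ->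
  (word_key g < word_key (upd h p S))%N.
Proof.
move=> mp agr lt; rewrite /word_key.
rewrite (bigID (fun r : 'I_k => r < m)%N) /= [X in (_ < X)%N](bigID (fun r : 'I_k => r < m)%N) /=.
rewrite [X in (_ + X < _)%N](bigD1 p) /= -?leqNgt // [X in (_ < _ + X)%N](bigD1 p) /= -?leqNgt //.
rewrite upd_same.
have -> : (\sum_(i < k | ~~ (i < m) && (i != p)) set_sum (upd h p S i) * B ^ i =
    \sum_(i < k | ~~ (i < m) && (i != p)) set_sum (g i) * B ^ i)%N.
  by apply: eq_bigr => r /andP[rm rp]; rewrite updE (negPf rp) agr // leqNgt.
have := prefix_key_lt g m; have : (B ^ m <= B ^ p)%N by rewrite leq_pexp2l.
have : (set_sum (g p) * B ^ p + B ^ p <= set_sum S * B ^ p)%N.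
  by rewrite -mulSnr leq_mul.
move=> keyS powB keyg; rewrite !addnA ltn_add2r.
apply: leq_trans (leq_addl _ _); apply: leq_trans keyS.
by rewrite addnC ltn_add2l; apply: leq_trans powB.
Qed.

Lemma prefix_weight_split (f : 'I_k -> {set 'I_n}) m i :
  (prefix_weight f k i = prefix_weight f m i + \sum_(r < k | m <= r) (i \in f r))%N.
Proof.
rewrite /prefix_weight (eq_bigl xpredT); last by move=> r; rewrite ltn_ord.
rewrite (bigID (fun r : 'I_k => r < m)%N) /=; congr (_ + _)%N.
by apply: eq_bigl => r; rewrite -leqNgt.
Qed.

(** The leading word g is the one of largest key in the support. Each prefix weight of g is the
    weight of a nonzero highest weight vector for the first m slots, hence dominant. *)
Lemma hw_vector_lattice la (x : space) : hw_vector (W := W) la x -> x != 0 ->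
  exists2 g, g \in lattice_words k (@beta_set n la) & x g != 0.
Proof.
move=> hwx x0.
have [g0 xg0] : exists g, x g != 0.
  apply/existsP; apply: contraNT x0 => /existsPn H; apply/eqP/ffunP => g.
  by rewrite ffunE; have := H g; rewrite negbK => /eqP.
pose g := [arg max_(g > g0 | x g != 0) word_key g].
have [xg gmax] : x g != 0 /\ forall h, x h != 0 -> (word_key h <= word_key g)%N.
  by rewrite /g; case: arg_maxnP.
exists g => //; rewrite inE; apply/andP; split; last first.
  by apply/forallP => i; rewrite (hw_vector_supp i hwx xg).
apply/lattice_wordP => m mk i j ij.
pose agr (h : word) := [forall r : 'I_k, (m <= r)%N ==> (h r == g r)].
have agrP (h : word) : reflect (forall r : 'I_k, (m <= r)%N -> h r = g r) (agr h).
  apply: (iffP forallP) => H r; first by move=> mr; apply/eqP/(implyP (H r)).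
  by apply/implyP => /H ->.
(* The part of x whose slots from m on are those of g. *)
pose y : space := [ffun h => if agr h then x h else 0].
have yv h : y h = if agr h then x h else 0 by rewrite ffunE.
have agr_upd h (p : 'I_k) S : (p < m)%N -> agr (upd h p S) = agr h.
  move=> pm; apply: eq_forallb => r; rewrite updE; case: (eqVneq r p) => [->|//].
  by rewrite leqNgt pm.
have yE a b h : eprefix m a b y h = if agr h then eprefix m a b x h else 0.
  rewrite !sum_ffunE -(fun_if (fun z : F => z)).
  transitivity (\sum_(p < k | (p < m)%N) (if agr h then eslot p a b x h else 0)).
    apply: eq_bigr => p pm; rewrite !creE !annE yv !agr_upd //.
    by case: (agr h); rewrite ?mulr0 ?if_same ?mulr0 ?if_same.
  by case: (agr h); rewrite // big1.
have y0 : y != 0.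
  apply: contraNneq xg => /ffunP/(_ g); rewrite yv ffunE => <-.
  by case: agrP => // -[].
(* The full E_ij kills x. A contribution of a slot p >= m would come from a word with i replaced by
   the larger j in that slot; such a word has a key above that of g, so x vanishes there. *)
have yij : eprefix m i j y = 0.
  apply/ffunP => h; rewrite yE ffunE; case: agrP => // hg.
  have [/(_ i j ij)/ffunP/(_ h)] := hwx; rewrite rep_act_slots sum_ffunE ffunE => e _.
  move: e; rewrite (bigID (fun p : 'I_k => p < m)%N) /= [X in _ + X]big1 ?addr0.
    by rewrite sum_ffunE.
  move=> p; rewrite -leqNgt => mp; rewrite creE; case: ifP => // ihp.
  rewrite annE upd_same; case: ifP => [_|/negbT jhp]; first by rewrite mulr0.
  rewrite upd_upd; have [->|nz] := eqVneq (x (upd h p (j |: h p :\ i))) 0.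
    by rewrite !mulr0.
  have := gmax _ nz; rewrite leqNgt (word_key_lt mp hg) //.
  by rewrite -hg // set_sum_exchange.
(* Words in the support of y have the total weight of g and its last slots, so their prefix weights
   at m agree too. *)
have ydiag a : eprefix m a a y = (prefix_weight g m a)%:R *: y.
  apply/ffunP => h; rewrite eprefix_diag [RHS]ffunE.
  have [->|yh] := eqVneq (y h) 0; first by rewrite mulr0 scaler0.
  congr (_%:R * _); move: yh; rewrite ffunE; case: agrP => [hg xh|]; last by rewrite eqxx.
  have := hw_vector_supp a hwx xh; have := hw_vector_supp a hwx xg => <-.
  rewrite !(prefix_weight_split _ m).
  rewrite (eq_bigr (fun r => (a \in g r) : nat)); last by move=> r mr; rewrite hg.
  by move/addIn.
exact: hw_weight_dominant y0 yij (ydiag i) (ydiag j).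
Qed.

Definition lattice_coords la (x : space) :
    'rV[F]_#|lattice_words k (@beta_set n la)| :=
  \row_l (x (enum_val l) : F).

Fact lattice_coords_linear la : linear (lattice_coords la).
Proof. by move=> a x y; apply/rowP => l; rewrite !mxE !ffunE. Qed.
HB.instance Definition _ la := GRing.isLinear.Build F space _ *:%R
  (lattice_coords la) (lattice_coords_linear la).

(** A highest weight vector whose coordinates at all lattice words vanish has no leading word, so it
    is zero. *)
Lemma dim_hw_space_le la :
  (\dim (hw_space W la) <= #|lattice_words k (@beta_set n la)|)%N.
Proof.
rewrite -(limg_dim_eq (f := linfun (lattice_coords la))).
  by rewrite (leq_trans (dimvS (subvf _))) // dimvf /dim /= mul1n.
apply/eqP; rewrite -subv0; apply/subvP => x /memv_capP[/(hw_spaceP (W := W)) hwx].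
rewrite memv_ker lfunE memv0 => /eqP/rowP e; apply: contraT => x0.
have [g gL] := hw_vector_lattice hwx x0.
by have := e (enum_rank_in gL g); rewrite !mxE enum_rankK_in // => ->; rewrite eqxx.
Qed.

End UpperBound.

(** * Highest weight vectors from column antisymmetrizers *)

Section CreationWords.
Variables (F : numClosedFieldType) (n k : nat).
Local Notation word := {ffun 'I_k -> {set 'I_n}}.
Local Notation space := {ffun word -> F^o}.
Local Notation W := (tens_rep (ext_rep F n) k).
Local Notation E i j := (@rep_act F n W (delta_mx i j)).
Local Notation box := ('I_k * 'I_n)%type.
Implicit Types (l : box -> 'I_n) (s : seq box) (v : space).

(** A box is a pair of a slot and a letter; the labelling [l] may create a different letter in its
    slot, which is how columns are permuted. *)
Definition creations l s v : space := foldr (fun b w => cre b.1 (l b) w) v s.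

Definition relabel l b i : box -> 'I_n := fun x => if x == b then i else l x.

Definition vacuum : space := bvec F [ffun=> set0].

Lemma creations_cons l b s v :
  creations l (b :: s) v = cre b.1 (l b) (creations l s v).
Proof. by []. Qed.

Lemma eq_creations l l' s v : {in s, l =1 l'} -> creations l s v = creations l' s v.
Proof.
elim: s => [//|b s IH] ll' /=; rewrite ll' ?mem_head // IH // => x xs.
by rewrite ll' // inE xs orbT.
Qed.

Lemma eq_creations_relabel l b i s v :
  b \notin s -> creations (relabel l b i) s v = creations l s v.
Proof.
move=> bs; apply: eq_creations => x xs; rewrite /relabel; case: eqP => // e.
by rewrite -e xs in bs.
Qed.

Lemma rep_act_cre i j p c v :
  E i j (cre p c v) = (j == c)%:R *: cre p i v + cre p c (E i j v).
Proof.
rewrite !rep_act_slots linear_sum (bigD1 p) // [in RHS](bigD1 p) //= addrA.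
congr (_ + _).
  rewrite /eslot -[ann p j (cre p c v)](addrK (cre p c (ann p j v))) ann_cre.
  by rewrite linearB linearZ /= [X in _ - X]creC eqxx opprK.
by apply: eq_bigr => r rp; rewrite /eslot ann_creC // creC (negPf rp).
Qed.

Lemma rep_act_creations i j l s v : uniq s -> E i j v = 0 ->
  E i j (creations l s v)
    = \sum_(b <- s) (l b == j)%:R *: creations (relabel l b i) s v.
Proof.
move=> us v0; elim: s us => [|b s IH]; first by rewrite big_nil.
rewrite cons_uniq => /andP[bs us]; rewrite creations_cons rep_act_cre IH // big_cons.
rewrite creations_cons [relabel l b i b]/relabel eqxx (eq_creations_relabel _ _ _ bs) eq_sym.
congr (_ + _); rewrite linear_sum big_seq [RHS]big_seq; apply: eq_bigr => x xs.
rewrite linearZ creations_cons [relabel l x i b]/relabel; case: (eqVneq b x) xs => [<-|//] xs.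
by rewrite xs in bs.
Qed.

Lemma rep_act_vacuum i j : E i j vacuum = 0.
Proof.
rewrite rep_act_slots big1 // => p _; rewrite /eslot [ann p j _](_ : _ = 0) ?linear0 //.
apply/ffunP => f; rewrite annE [RHS]ffunE; case: ifP => // _.
rewrite ffunE (_ : (_ == _) = false) ?mulr0 //.
apply/eqP => /ffunP/(_ p); rewrite upd_same ffunE => /setP/(_ j).
by rewrite !inE eqxx.
Qed.

(** Two creation operators in one slot anticommute, so exchanging their letters costs a sign; the
    operators in between contribute equally on both sides. *)
Lemma cre_creations_swap l s v b (p : 'I_k) i j : uniq s -> b \in s -> b.1 = p ->
  cre p i (creations (relabel l b j) s v) = - cre p j (creations (relabel l b i) s v).
Proof.
move=> us bs bp; elim: s us bs => [//|x s IH] /= /andP[xs us].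
rewrite inE; case: eqVneq => [e _|bx /= bs].
  rewrite /relabel -e eqxx bp -!/(relabel _ _ _) !eq_creations_relabel ?e //.
  by rewrite creC eqxx.
rewrite /relabel eq_sym (negPf bx) -!/(relabel _ _ _).
rewrite creC [in RHS]creC; case: eqP => _; rewrite IH // !linearN //= ?opprK.
Qed.

Lemma creations_tperm l s v b b' : uniq s -> b \in s -> b' \in s -> b != b' ->
  b.1 = b'.1 -> creations (l \o tperm b b') s v = - creations l s v.
Proof.
move=> us bs bs' ne e1; elim: s us bs bs' => [//|x s IH] /= /andP[xs us].
(* The case in which the first box x is one of the two: its partner in the rest of the list receives
   its letter. *)
have half c c' : c != c' -> c.1 = c'.1 -> x = c -> c' \in s ->
    cre x.1 (l (tperm c c' x)) (creations (l \o tperm c c') s v)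
      = - cre x.1 (l x) (creations l s v).
  move=> cc' e xc c's; rewrite xc tpermL.
  have -> : creations (l \o tperm c c') s v = creations (relabel l c' (l c)) s v.
    apply: eq_creations => y ys; rewrite /relabel /=; case: eqVneq => [->|yc'].
      by rewrite tpermR.
    rewrite tpermD //; last by rewrite eq_sym.
    by apply: contraNneq xs => cy; rewrite xc cy.
  rewrite cre_creations_swap // -?xc; congr (- cre _ _ _).
  by apply: eq_creations => y ys; rewrite /relabel; case: eqP => [->|].
rewrite !inE; case: (eqVneq b x) => [bx _|bx /= bs]; last case: (eqVneq b' x) => [bx' _|bx' /= bs'].
- rewrite -bx eq_sym (negPf ne) /= => b's; rewrite bx in ne e1 b's *.
  by apply: half => //; rewrite bx.
- by rewrite tpermC; apply: half => //; rewrite 1?eq_sym.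
- by rewrite tpermD // IH // linearN.
Qed.

(** For fixed letters and slots this is larger when large letters sit in late slots; it orders the
    words in a column antisymmetrizer. *)
Definition word_moment (g : word) : nat := (\sum_p \sum_(i in g p) i * p)%N.

Lemma creations_supp l s g : creations l s vacuum g != 0 ->
  (forall p, g p = [set i | has (fun b => (b.1 == p) && (l b == i)) s])
  /\ (word_moment g = \sum_(b <- s) l b * b.1)%N.
Proof.
elim: s g => [|b s IH] g /=.
  rewrite ffunE; case: (g =P _) => [-> _|]; last by rewrite eqxx.
  split=> [p|]; first by rewrite ffunE; apply/setP => i; rewrite !inE.
  by rewrite big_nil /word_moment big1 // => p _; rewrite ffunE big_set0.
rewrite creE; case: ifP => [lbg|]; last by rewrite eqxx.
move=> nz; have /IH[gE mE] : creations l s vacuum (upd g b.1 (g b.1 :\ l b)) != 0.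
  by apply: contraNneq nz => ->; rewrite mulr0.
split=> [p|].
  have := gE p; rewrite updE; case: eqVneq => [-> {}gE|ne ->].
    by rewrite -(setD1K lbg) gE; apply/setP => i; rewrite !inE /= eq_sym.
  by apply/setP => i; rewrite !inE /=.
rewrite big_cons -mE /word_moment (bigD1 b.1) // [in RHS](bigD1 b.1) //=.
rewrite upd_same (big_setD1 _ lbg) /= -addnA; congr (_ + (_ + _))%N.
by apply: eq_bigr => p /negPf pb; rewrite updE pb.
Qed.

Lemma creations_word_neq0 s : uniq s ->
  creations snd s vacuum [ffun p => [set i | (p, i) \in s]] != 0.
Proof.
elim: s => [_|[p i] s IH] /=.
  rewrite (_ : [ffun p => _] = [ffun=> set0]); first by rewrite ffunE eqxx oner_eq0.
  by apply/ffunP => p; rewrite !ffunE; apply/setP => i; rewrite !inE.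
case/andP => ns /IH nz; rewrite creE ffunE inE mem_head.
rewrite mulf_neq0 ?signr_eq0 //; congr (_ != 0): nz; congr (creations _ _ _ _).
apply/ffunP => r; rewrite updE !ffunE; case: eqVneq => [->|ne]; apply/setP => j.
  rewrite !inE xpair_eqE eqxx /=; case: eqVneq => [->|//].
  by rewrite (negPf ns).
by rewrite !inE xpair_eqE (negPf ne).
Qed.

End CreationWords.

(** The two sides differ by (y - x)(r - p). *)
Lemma rearrangement2 (x y p r : nat) : (x < y)%N -> (p <= r)%N ->
  (x * r + y * p <= y * r + x * p)%N /\ (x * r + y * p = y * r + x * p -> p = r)%N.
Proof.
move=> /subnKC <- /subnKC <-; set d := (y - _)%N; set e := (r - p)%N.
have -> : ((x.+1 + d) * (p + e) + x * p = x * (p + e) + (x.+1 + d) * p + d.+1 * e)%N.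
  by ring.
split; first exact: leq_addr.
by move/eqP; rewrite -[X in X == _]addn0 eqn_add2l eq_sym muln_eq0 => /eqP ->; rewrite addn0.
Qed.

Section ColumnAntisymmetrizer.
Variables (F : numClosedFieldType) (n k : nat) (f : {ffun 'I_k -> {set 'I_n}}).
Hypothesis f_lat : lattice_word f.
Local Notation word := {ffun 'I_k -> {set 'I_n}}.
Local Notation space := {ffun word -> F^o}.
Local Notation W := (tens_rep (ext_rep F n) k).
Local Notation E i j := (@rep_act F n W (delta_mx i j)).
Local Notation box := ('I_k * 'I_n)%type.
Implicit Types (b : box) (s : {perm box}).

(* A letter i in slot p is a box of row i of the diagram; its column is the
   length of row i before slot p. *)
Definition boxes : {set box} := [set b | b.2 \in f b.1].

Definition box_col b : nat := prefix_weight f b.1 b.2.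

Lemma prefix_weightS (p : 'I_k) i :
  prefix_weight f p.+1 i = (prefix_weight f p i + (i \in f p))%N.
Proof.
rewrite /prefix_weight (bigD1 p) //= addnC; congr (_ + _)%N.
by apply: eq_bigl => r; rewrite ltnS (ltn_neqAle r) andbC.
Qed.

Lemma prefix_weight_mono p p' i : (p <= p')%N ->
  (prefix_weight f p i <= prefix_weight f p' i)%N.
Proof.
move=> pp'; rewrite /prefix_weight big_mkcond [X in (_ <= X)%N]big_mkcond.
apply: leq_sum => r _; case: ifP => // rp.
by rewrite (leq_trans rp).
Qed.

Lemma box_col_lt b (p : nat) : b \in boxes -> (b.1 < p)%N ->
  (box_col b < prefix_weight f p b.2)%N.
Proof.
rewrite inE => fb bp; apply: leq_trans (prefix_weight_mono _ bp).
by rewrite prefix_weightS fb addn1.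
Qed.

(** Row i grows by at most one box per slot, so every column below its length was filled at some
    slot. *)
Lemma box_in_col i p c : (p <= k)%N -> (c < prefix_weight f p i)%N ->
  exists b, [/\ b \in boxes, b.2 = i & box_col b = c].
Proof.
elim: p => [|p IH] pk; first by rewrite /prefix_weight big1.
rewrite (prefix_weightS (Ordinal pk)) /=; case: (boolP (i \in f (Ordinal pk))) => fi.
  rewrite addn1 ltnS leq_eqVlt => /orP[/eqP ->|]; last exact/IH/ltnW.
  by exists (Ordinal pk, i); rewrite inE.
by rewrite addn0; apply/IH/ltnW.
Qed.

(** Dominance right after slot [b.1] makes row i at least as long as row [b.2], so row i reaches the
    column of b. *)
Lemma box_above b (i : 'I_n) : b \in boxes -> (i < b.2)%N ->
  exists b', [/\ b' \in boxes, b'.2 = i & box_col b' = box_col b].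
Proof.
move=> bb ib; apply: (@box_in_col _ b.1.+1); first exact: ltn_ord.
apply: leq_trans (box_col_lt bb (leqnn _)) _.
by apply: (lattice_wordP _ f_lat) => //; apply: ltn_ord.
Qed.

Lemma box_col_inj b b' : b \in boxes -> b' \in boxes -> box_col b = box_col b' ->
  b.2 = b'.2 -> b = b'.
Proof.
case: b b' => [p i] [p' i'] bb bb' e /= ei; subst i'; congr pair; apply: ord_inj.
move: e; rewrite /box_col /= => e; case: (ltngtP p p') => // lt.
  by have := box_col_lt bb lt; rewrite /box_col /= e ltnn.
by have := box_col_lt bb' lt; rewrite /box_col /= e ltnn.
Qed.

(** If the box in the lower row came strictly first, the prefix ending with it would not be
    dominant. *)
Lemma box_col_slot b b' : b \in boxes -> b' \in boxes -> box_col b = box_col b' ->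
  (b.2 < b'.2)%N -> (b.1 <= b'.1)%N.
Proof.
move=> bb bb' e lt; rewrite leqNgt; apply/negP => lt1.
have := box_col_lt bb' (leqnn _); rewrite -e ltnNge.
have := prefix_weight_mono b.2 lt1 => /(leq_trans _) -> //.
by apply: (lattice_wordP _ f_lat) => //; apply: ltn_ord.
Qed.

(** The column group of the diagram, extended by the identity outside of it. *)
Definition column_perms : {set {perm box}} :=
  [set s | perm_on boxes s & [forall b in boxes, box_col (s b) == box_col b]].

Lemma column_permP s : reflect
  [/\ perm_on boxes s, forall b, b \in boxes -> s b \in boxes
    & forall b, b \in boxes -> box_col (s b) = box_col b] (s \in column_perms).
Proof.
rewrite inE; apply: (iffP andP) => [[on /forall_inP H]|[on _ H]]; split=> //.
- by move=> b; rewrite (perm_closed _ on).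
- by move=> b /H/eqP.
- by apply/forall_inP => b /H ->.
Qed.

Lemma column_perm1 : 1%g \in column_perms.
Proof.
by rewrite inE perm_on1; apply/forall_inP => b _; rewrite perm1.
Qed.

Lemma tperm_column b b' : b \in boxes -> b' \in boxes -> box_col b = box_col b' ->
  tperm b b' \in column_perms.
Proof.
move=> bb bb' e; rewrite inE; apply/andP; split; last first.
  by apply/forall_inP => c _; case: tpermP => [->|->|] //; rewrite e.
apply/subsetP => c; rewrite inE; case: tpermP => [->|->|] //.
by rewrite eqxx.
Qed.

Lemma column_permM s t : s \in column_perms -> t \in column_perms ->
  (s * t)%g \in column_perms.
Proof.
move=> /column_permP[sO sB sC] /column_permP[tO tB tC]; rewrite inE perm_onM //=.
by apply/forall_inP => b bb; rewrite permM tC ?sB // sC.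
Qed.

Definition labels s : box -> 'I_n := fun b => (s b).2.

Local Notation term s := (creations (labels s) (enum boxes) (vacuum F n k)).

Definition tableau_vector : space :=
  \sum_(s in column_perms) (-1) ^+ (s : bool) *: term s.

(** Raising replaces one letter j by i in a column that already holds an i, and antisymmetry in
    these two boxes makes the result vanish. *)
Lemma raise_tableau (i j : 'I_n) : (i < j)%N -> E i j tableau_vector = 0.
Proof.
move=> ij.
pose R s b := creations (relabel (labels s) b i) (enum boxes) (vacuum F n k).
(* The terms are grouped by the box b of row j to which s sends the box that is relabelled. *)
have -> : E i j tableau_vector = \sum_(b in boxes | b.2 == j)
    \sum_(s in column_perms) (-1) ^+ (s : bool) *: R s ((s^-1)%g b).
  rewrite linear_sum [RHS](exchange_big_dep [in column_perms]) //=.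
  apply: eq_bigr => s sG; have [on _ _] := column_permP _ sG; rewrite linearZ.
  rewrite -[X in _ *: X = _]/(E i j (term s)) rep_act_creations ?enum_uniq ?rep_act_vacuum // -scaler_sumr.
  congr (_ *: _); rewrite big_enum /= [RHS](reindex_inj (@perm_inj _ s)) /=.
  rewrite [RHS](eq_bigl (fun b => (b \in boxes) && ((s b).2 == j))); last first.
    by move=> b; rewrite (perm_closed _ on) sG andbT.
  rewrite [RHS]big_mkcondr /=; apply: eq_bigr => b _.
  rewrite permK -/(R s b) /labels; case: eqP => _; first exact: scale1r.
  exact: scale0r.
apply: big1 => b /andP[bb /eqP bj]; set X := \sum_(s in _) _.
have [b' [bb' bi' cb']] : exists b', [/\ b' \in boxes, b'.2 = i & box_col b' = box_col b].
  by apply: box_above => //; rewrite bj.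
have bb'ne : b != b'.
  by apply: contraTneq ij => e; rewrite -bi' -e bj ltnn.
pose t := tperm b b'.
have tG : t \in column_perms by apply: tperm_column.
have tt : (t * t = 1)%g by apply: tperm2.
(* Composing s with the transposition permutes the sum and flips the signs. The labels do not
   change, as the boxes sent to b and b' now both carry i. *)
have XN : X = - X.
  rewrite {1}/X (reindex_inj (@mulIg _ t)) -sumrN /=; apply: eq_big => s.
    apply/idP/idP => [H|H]; last exact: column_permM.
    by rewrite -[s]mulg1 -tt mulgA column_permM.
  move=> _; rewrite odd_permM odd_tperm bb'ne addbT signrN scaleNr; congr (- (_ *: _)).
  rewrite /R; apply: eq_creations => c _; rewrite /relabel /labels invMg permM tpermV tpermL.
  rewrite permM; case: (eqVneq c (s^-1 b')%g) => [->|cb'ne].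
    by rewrite permKV bi' if_same.
  case: (eqVneq c (s^-1 b)%g) => [->|cbne]; first by rewrite permKV tpermL.
  rewrite tpermD //; first by apply: contraNneq cbne => ->; rewrite permK.
  by apply: contraNneq cb'ne => ->; rewrite permK.
apply/eqP; have := XN => /eqP; rewrite -addr_eq0 -mulr2n -scaler_nat scaler_eq0.
by rewrite pnatr_eq0.
Qed.

Lemma weight_tableau (i : 'I_n) :
  E i i tableau_vector = (prefix_weight f k i)%:R *: tableau_vector.
Proof.
rewrite linear_sum scaler_sumr; apply: eq_bigr => s /column_permP[on _ _].
rewrite linearZ scalerA mulrC -scalerA; congr (_ *: _).
rewrite -[LHS]/(E i i (term s)) rep_act_creations ?enum_uniq ?rep_act_vacuum //.
rewrite (eq_bigr (fun b => (labels s b == i)%:R *: term s)); last first.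
  move=> b _; case: eqP => e; last by rewrite !scale0r.
  congr (_ *: _); apply: eq_creations => c _; rewrite /relabel.
  by case: eqP => // ->; rewrite e.
rewrite -scaler_suml -natr_sum; congr (_%:R *: _); rewrite big_enum /=.
rewrite [RHS](_ : _ = \sum_(b in boxes) (b.2 == i))%N.
  rewrite [RHS](reindex_inj (@perm_inj _ s)) /=; apply: eq_bigl => b.
  by rewrite (perm_closed _ on).
rewrite big_mkcond /= (eq_bigr (fun b => if (b.1, b.2) \in boxes then b.2 == i : nat else 0%N)); last by case.
rewrite -(pair_bigA _ (fun p a => if (p, a) \in boxes then a == i : nat else 0%N)) /=.
rewrite /prefix_weight; apply: eq_big => [p|p _]; first by rewrite ltn_ord.
rewrite (bigD1 i) //= inE eqxx big1 ?addn0 => [|a /negPf ->]; last by rewrite if_same.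
by case: (i \in f p).
Qed.

(* Rearrangement inequality: within a column the slots increase with the
   labels. *)
Lemma column_perm_moment s : s \in column_perms ->
  (\sum_(b in boxes) (s b).2 * b.1 <= \sum_(b in boxes) b.2 * b.1)%N
  /\ ((\sum_(b in boxes) (s b).2 * b.1 = \sum_(b in boxes) b.2 * b.1)%N ->
     (forall b, (s b).1 = b.1)
     /\ (-1) ^+ (s : bool) *: term s = term 1%g).
Proof.
have [m] := ubnP #|[set b | s b != b]|; elim: m s => // m IH s sm sG.
have [on sB sC] := column_permP _ sG.
have [s1|[b0' mv0']] : s = 1%g \/ exists b, s b != b.
  case: (boolP [exists b, s b != b]) => [/existsP|]; first by right.
  by rewrite negb_exists => /forallP H; left; apply/permP => b; rewrite perm1;
     apply/eqP; have := H b; rewrite negbK.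
  rewrite s1; split=> [|_].
    by rewrite leq_eqVlt; apply/orP; left; apply/eqP; apply: eq_bigr => b _; rewrite perm1.
  by split=> [b|]; rewrite ?perm1 // odd_perm1 scale1r.
(* The choice of a moved box in the lowest possible row puts its preimage b1 and its image b2 in
   strictly higher rows of the same column. *)
have [b0 mv0 b0max] : exists2 b0, s b0 != b0 & forall b, s b != b -> (b.2 <= b0.2)%N.
  by case: (@arg_maxnP _ b0' (fun b => s b != b) (fun b : box => b.2 : nat) mv0') => b0 H1 H2; exists b0.
have mvB b : s b != b -> b \in boxes.
  by move=> mv; move/subsetP: on; apply; rewrite inE.
pose b1 := (s^-1 b0)%g; pose b2 := s b0.
have sb1 : s b1 = b0 by rewrite permKV.
have b10 : b1 != b0 by apply: contraNneq mv0 => e; rewrite -{1}e sb1.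
have mv1 : s b1 != b1 by rewrite sb1 eq_sym.
have mv2 : s b2 != b2 by apply: contraNneq mv0 => /perm_inj e; apply/eqP.
have bb0 := mvB _ mv0; have bb1 := mvB _ mv1; have bb2 := mvB _ mv2.
have c10 : box_col b1 = box_col b0 by rewrite -sC // sb1.
have c20 : box_col b2 = box_col b0 by rewrite sC.
have lt1 : (b1.2 < b0.2)%N.
  rewrite ltn_neqAle b0max // andbT; apply: contraNneq b10 => /ord_inj e.
  by apply/eqP; apply: box_col_inj.
have lt2 : (b2.2 < b0.2)%N.
  rewrite ltn_neqAle b0max // andbT; apply: contraNneq mv0 => /ord_inj e.
  by apply/eqP; apply: box_col_inj.
have p10 : (b1.1 <= b0.1)%N by apply: box_col_slot.
(* The permutation s' fixes b0 and sends b1 straight to b2, so it moves fewer boxes, and its moment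
   is at least that of s. *)
pose t := tperm b1 b0; pose s' := (t * s)%g.
have s'G : s' \in column_perms by apply: column_permM => //; apply: tperm_column.
have s'0 : s' b0 = b0 by rewrite permM tpermR.
have s'1 : s' b1 = b2 by rewrite permM tpermL.
have s'E b : b != b0 -> b != b1 -> s' b = s b.
  by move=> ne0 ne1; rewrite permM tpermD // eq_sym.
have card' : (#|[set b | s' b != b]| < m)%N.
  rewrite ltnS in sm; apply: leq_trans sm; apply: proper_card.
  apply/properP; split; last by exists b0; rewrite !inE ?s'0 ?eqxx.
  apply/subsetP => b; rewrite !inE; case: (eqVneq b b0) => [->|ne0]; first by rewrite s'0 eqxx.
  by case: (eqVneq b b1) => [-> _|ne1]; [exact: mv1|rewrite s'E].
have [le' eq'] := IH _ card' s'G.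
have split2 (g : box -> nat) : (\sum_(b in boxes) g b =
    g b0 + (g b1 + \sum_(b in boxes | (b != b0) && (b != b1)) g b))%N.
  rewrite (bigD1 b0) //= (bigD1 b1) /=; last by rewrite bb1.
  by congr (_ + (_ + _))%N; apply: eq_bigl => b; rewrite andbA.
have E1 := split2 (fun b => (s b).2 * b.1)%N.
have E2 := split2 (fun b => (s' b).2 * b.1)%N.
have E3 : (\sum_(b in boxes | (b != b0) && (b != b1)) (s b).2 * b.1 =
           \sum_(b in boxes | (b != b0) && (b != b1)) (s' b).2 * b.1)%N.
  by apply: eq_bigr => b /and3P[_ ne0 ne1]; rewrite s'E.
rewrite s'0 s'1 -E3 in E2; rewrite sb1 -/b2 in E1.
move: (\sum_(b in boxes | _) _)%N E1 E2 => rest E1 E2.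
have le : (\sum_(b in boxes) (s b).2 * b.1 <= \sum_(b in boxes) (s' b).2 * b.1)%N.
  by rewrite E1 E2 !addnA leq_add2r; have [] := rearrangement2 lt2 p10.
split=> [|eqs]; first exact: leq_trans le le'.
have eqs' : (\sum_(b in boxes) (s' b).2 * b.1 = \sum_(b in boxes) b.2 * b.1)%N.
  by apply/eqP; rewrite eqn_leq le' -eqs le.
have [fix' term'] := eq' eqs'.
(* Equality of the moments forces b1 and b0 into one slot, where exchanging two letters produces
   just the sign of t. *)
have e10 : b1.1 = b0.1.
  apply: ord_inj; move: eqs; rewrite -eqs' E1 E2 !addnA => /addIn.
  by have [] := rearrangement2 lt2 p10.
split=> [b|].
  case: (eqVneq b b0) => [->|ne0]; first by rewrite -/b2 -s'1 fix'.
  case: (eqVneq b b1) => [->|ne1]; first by rewrite sb1.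
  by rewrite -s'E.
rewrite -term' odd_permM odd_tperm b10 addTb signrN scaleNr -scalerN; congr (_ *: _).
have -> : term s = creations (labels s' \o t) (enum boxes) (vacuum F n k).
  by apply: eq_creations => b _; rewrite /labels /= permM /t tpermK.
by rewrite creations_tperm ?enum_uniq ?mem_enum.
Qed.

Lemma boxes_word : [ffun p => [set i | (p, i) \in enum boxes]] = f.
Proof. by apply/ffunP => p; rewrite ffunE; apply/setP => i; rewrite !inE mem_enum inE. Qed.

Lemma term1_neq0 : term 1%g f != 0.
Proof.
have -> : term 1%g = creations snd (enum boxes) (vacuum F n k).
  by apply: eq_creations => b _; rewrite /labels perm1.
by have := creations_word_neq0 F (enum_uniq boxes); rewrite boxes_word.
Qed.

Lemma term_supp s g : s \in column_perms -> term s g != 0 ->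
  word_moment g = (\sum_(b in boxes) (s b).2 * b.1)%N
  /\ ((forall b, (s b).1 = b.1) -> g = f).
Proof.
move=> sG /creations_supp[gE ->]; rewrite big_enum /=; split=> // fix1.
have [on _ _] := column_permP _ sG.
apply/ffunP => p; rewrite gE; apply/setP => i; rewrite inE; apply/hasP/idP.
  case=> b; rewrite mem_enum -(perm_closed _ on) inE fix1 /labels.
  by move=> + /andP[/eqP <- /eqP <-].
move=> fi; exists (s^-1 (p, i))%g.
  by rewrite mem_enum -(perm_closed _ on) permKV inE.
by rewrite -[(s^-1 _)%g.1]fix1 /labels permKV !eqxx.
Qed.

Lemma word_moment_boxes : word_moment f = (\sum_(b in boxes) b.2 * b.1)%N.
Proof.
have [-> _] := term_supp column_perm1 term1_neq0.
by apply: eq_bigr => b _; rewrite perm1.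
Qed.

Lemma tableau_supp g : tableau_vector g != 0 ->
  (word_moment g < word_moment f)%N \/ g = f.
Proof.
move=> nz; have [s [sG sg]] : exists s, s \in column_perms /\ term s g != 0.
  apply: contrapT => H; case/eqP: nz; rewrite sum_ffunE big1 // => s sG.
  rewrite ffunE (_ : term s g = 0) ?scaler0 //; apply/eqP; apply: contrapT => /negP nz.
  by apply: H; exists s.
have [mg eqf] := term_supp sG sg; have [le eqm] := column_perm_moment sG.
rewrite mg word_moment_boxes; move: le; rewrite leq_eqVlt => /orP[/eqP/eqm[fix1 _]|]; last by left.
by right; apply: eqf.
Qed.

(** Only the permutations that preserve all slots contribute at f, and each of them contributes the
    same as the identity, so nothing cancels in characteristic zero. *)
Lemma tableau_lead : tableau_vector f != 0.
Proof.
rewrite sum_ffunE.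
rewrite (bigID (fun s => [forall b, (s b).1 == b.1])) /= [X in _ + X]big1 ?addr0; last first.
  move=> s /andP[sG nfix]; rewrite ffunE; have [->|nz] := eqVneq (term s f) 0.
    by rewrite scaler0.
  have [mf _] := term_supp sG nz; have [_ eqm] := column_perm_moment sG.
  case/negP: nfix; apply/forallP => b; apply/eqP; apply: (eqm _).1.
  by rewrite -mf word_moment_boxes.
rewrite (eq_bigr (fun=> term 1%g f)); last first.
  move=> s /andP[sG /forallP fix1]; have [_ eqm] := column_perm_moment sG.
  have [on _ _] := column_permP _ sG.
  suff /eqm[_ <-] : (\sum_(b in boxes) (s b).2 * b.1 = \sum_(b in boxes) b.2 * b.1)%N by [].
  rewrite [RHS](reindex_inj (@perm_inj _ s)) /=; apply: eq_big => b.
    by rewrite (perm_closed _ on).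
  by rewrite (eqP (fix1 b)).
rewrite sumr_const -mulr_natr mulf_neq0 ?term1_neq0 // pnatr_eq0 -lt0n.
apply/card_gt0P; exists 1%g; rewrite unfold_in column_perm1.
by apply/forallP => b; rewrite perm1.
Qed.

End ColumnAntisymmetrizer.

Section LowerBound.
Variables (F : numClosedFieldType) (n k : nat).
Local Notation word := {ffun 'I_k -> {set 'I_n}}.
Local Notation space := {ffun word -> F^o}.
Local Notation W := (tens_rep (ext_rep F n) k).

Lemma tableau_hw la (f : word) : f \in lattice_words k (@beta_set n la) ->
  hw_vector (W := W) la (tableau_vector F f).
Proof.
rewrite inE => /andP[f_lat /forallP wt]; split=> [i j ij|i].
  exact: raise_tableau.
rewrite weight_tableau; congr (_%:R *: _).
by have /eqP := wt i; rewrite /beta_set => /addIn.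
Qed.

(** Among the words with nonzero coefficient take one of largest moment: by [tableau_supp] no other
    vector of the combination has it in its support. *)
Lemma tableau_independent (m : nat) (w : 'I_m -> word) (c : 'I_m -> F) :
  injective w -> (forall l, lattice_word (w l)) ->
  \sum_l c l *: tableau_vector F (w l) = 0 -> forall l, c l = 0.
Proof.
move=> winj wlat sum0 l; apply/eqP; apply: contraT => cl.
case: (@arg_maxnP _ l (fun l => c l != 0) (fun l => word_moment (w l)) cl) => l0 cl0 l0max.
move/ffunP/(_ (w l0)): sum0; rewrite sum_ffunE (bigD1 l0) //= big1 => [|l1 ne].
  rewrite addr0 !ffunE => /eqP; rewrite mulf_eq0 (negPf cl0) /=.
  by rewrite (negPf (tableau_lead F (wlat l0))).
rewrite ffunE; have [->|cl1] := eqVneq (c l1) 0; first exact: mul0r.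
have [->|/(tableau_supp (wlat l1))[lt|/winj e]] := eqVneq (tableau_vector F (w l1) (w l0)) 0.
- exact: mulr0.
- by have := l0max _ cl1; rewrite /= leqNgt lt.
- by rewrite e eqxx in ne.
Qed.

Lemma dim_hw_space_ge la :
  (#|lattice_words k (@beta_set n la)| <= \dim (hw_space W la))%N.
Proof.
set L := lattice_words _ _.
pose X := [tuple tableau_vector F (enum_val l) | l < #|L|].
have lat (l : 'I_#|L|) : lattice_word (enum_val l : word).
  by have := enum_valP l; rewrite inE => /andP[].
have freeX : free X.
  apply/freeP => c; rewrite (eq_bigr (fun l => c l *: tableau_vector F (enum_val l))).
    by apply: tableau_independent => //; apply: enum_val_inj.
  by move=> l _; rewrite -tnth_nth tnth_mktuple.
have := freeX; rewrite /free size_tuple => /eqP <-.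
apply: dimvS; apply/span_subvP => x /tnthP[l ->]; rewrite tnth_mktuple.
by apply/(hw_spaceP (W := W))/tableau_hw/enum_valP.
Qed.

Lemma dim_hw_space la : \dim (hw_space W la) = #|lattice_words k (@beta_set n la)|.
Proof. by apply/eqP; rewrite eqn_leq dim_hw_space_le dim_hw_space_ge. Qed.

End LowerBound.

(** * The indeterminate q, the value q = 1 and the theorem *)

Lemma qint_tofracX_neq0 m : qint (tofrac 'X : {fraction {poly int}}) m.+1 != 0.
Proof.
have -> : qint (tofrac 'X) m.+1 = tofrac (\sum_(i < m.+1) 'X^i) :> {fraction {poly int}}.
  by rewrite rmorph_sum; apply: eq_bigr => i _; rewrite rmorphXn.
rewrite tofrac_eq0; apply/eqP => /(congr1 (fun p : {poly int} => p.[1])).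
rewrite horner0 horner_sum (eq_bigr (fun=> 1)) => [|i _]; last first.
  by rewrite hornerXn expr1n.
by rewrite sumr_const card_ord => /eqP; rewrite pnatr_eq0.
Qed.

Lemma qint1_rat_neq0 m : qint (1 : rat) m.+1 != 0.
Proof.
rewrite /qint (eq_bigr (fun=> 1)) => [|i _]; last by rewrite expr1n.
by rewrite sumr_const card_ord pnatr_eq0.
Qed.

Theorem theorem4p6 (R : realType) (n k : nat) (la : seq nat)
    (n_gt0 : (0 < n)%N) (k_gt0 : (0 < k)%N) (la_rect : in_rect n k la) :
  let q : {fraction {poly int}} := tofrac 'X in
  let a (i : nat) := (part la i + n - i)%N in
  let lac := complement n k la in
  [/\ MA q n k la =
        q ^+ part_norm lac *
        (((\prod_(0 <= m < n) qfact q (k + m)) *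
          (\prod_(1 <= i < n.+1) \prod_(i.+1 <= j < n.+1) qint q (a i - a j)))
         / (\prod_(1 <= i < n.+1) (qfact q (a i) * qfact q (k + n - 1 - a i)))),
      MA q n k la = q ^+ part_norm lac * qdim q k (conj_part k lac),
      MA q n k la = q ^+ part_norm lac * qdim q k (conj_part k la),
      (exists p : {poly int}, (forall i, 0 <= p`_i) /\ MA q n k la = tofrac p)
    & exists m : nat,
        is_multiplicity (tens_rep (ext_rep R[i] n) k) la m /\
        MA (1 : rat) n k la = m%:R].
Proof.
move=> q a lac.
have q_int := qint_tofracX_neq0; rewrite -/q in q_int.
have q0 : q != 0 by rewrite tofrac_eq0 polyX_eq0.
have q1 : q != 1.
  rewrite -tofrac1 tofrac_eq; apply/eqP => /(congr1 (fun p : {poly int} => size p)).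
  by rewrite size_polyX size_poly1.
have beta_decr (i j : 'I_n) : (i < j)%N -> (beta_set la j <= beta_set la i)%N.
  by move/(beta_set_decr la_rect)/ltnW.
split.
- rewrite (MA_qhook la_rect q_int q0) prod_pairs /qhook big_mkord.
  rewrite big_add1 big_mkord; congr (_ * (_ * _ / _)).
    apply: eq_bigr => i _; apply: eq_bigr => j _; congr qint.
    by rewrite /beta_set /a /=; have := ltn_ord i; have := ltn_ord j; lia.
  apply: eq_bigr => i _; rewrite /a /beta_set /=.
  by congr (qfact _ _ * qfact _ _); have := ltn_ord i; lia.
- rewrite (MA_qhook la_rect q_int q0) (qdim_conj_part (complement_rect la_rect) q_int q0 q1).
  congr (_ * _); apply: esym; exact: (qhook_complement_part la_rect q0).
- by rewrite (MA_qhook la_rect q_int q0) (qdim_conj_part la_rect q_int q0 q1).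
- rewrite MA_qdet.
  pose nonneg x := exists p : {poly int}, (forall i, 0 <= p`_i) /\ x = tofrac p.
  apply: (@qdet_closed _ q q_int q0 n k nonneg) => // [||x y|x].
  + by exists 0; split=> [i|]; rewrite ?coef0 ?tofrac0.
  + by exists 1; split=> [i|]; rewrite ?coef1 ?tofrac1 //; case: eqP.
  + move=> [p [p0 ->]] [p' [p'0 ->]]; exists (p + p'); rewrite tofracD.
    by split=> // i; rewrite coefD addr_ge0.
  + move=> [p [p0 ->]]; exists ('X * p); rewrite tofracM.
    by split=> // i; rewrite coefXM; case: eqP.
(* The number of lattice words is both the dimension of the space of highest weight vectors and the
   value of the determinant at q = 1. *)
- exists #|lattice_words k (@beta_set n la)|; split.
    rewrite -(@dim_hw_space R[i]); apply: multiplicity_unitary.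
    exact: tens_ext_unitary.
  by rewrite MA_qdet qdet1_lattice //; apply: qint1_rat_neq0.
Qed.
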